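(* Let $\sigma>0$. There exist universal constants $\gamma>2\log 3$ and $c_0>0$ for which the Fourier thresholding estimator $\hat f_n$ defined with these constants has the property in (i) below. For every $\varepsilon\in(0,1)$ there exist constants $c,C>0$, depending only on $\sigma$ and $\varepsilon$, such that the following holds for all integers $n\ge2$ and $d\ge1$. For $K>0$ and $B\in(0,K]$ let $\mathcal F_{K,B}=\{f\in\mathcal F_K : I^{(2)}(f)\le B\}$. (i) (Upper bound) For every $K$ with $1\le K\le\sqrt{\log n}$ and every $B$ with $1\le B\le K$, if $\log d\le n^{1-\varepsilon}$, then $$\sup_{f\in\mathcal F_{K,B}}R(\hat f_n,f)\;\le\; C\,\frac{B}{\sqrt{\log n}},$$ for every admissible noise distribution. (ii) (Lower bound) For every $K$ with $0<K\le c\sqrt{\log n}$, every $B\in(0,K^2/\sqrt{\log n}]$, and $d\ge(1/c)\log n$, $$\inf_{\tilde f}\ \sup_{f\in\mathcal F_{K,B}}R(\tilde f,f)\;\ge\; c\,\frac{B}{\log n},$$ where the infimum is over all estimators $\tilde f=\tilde f(\mathcal D_n)$ and the supremum is understood in the worst case over admissible noise distributions as well as over $f\in\mathcal F_{K,B}$.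
   Context: Model. $\{0,1\}^d$ carries the coordinatewise partial order and the uniform probability measure $\mu$. One observes $\mathcal D_n=\{(X_1,Y_1),\dots,(X_n,Y_n)\}$ with $Y_j=f(X_j)+\varepsilon_j$, where $X_1,\dots,X_n$ are i.i.d. with law $\mu$, and $\varepsilon_1,\dots,\varepsilon_n$ are independent centered real random variables, independent of the $X_j$, with $\mathbb E[e^{t\varepsilon_j}]\le e^{\sigma^2t^2/2}$ for all $t\in\mathbb R$. Any joint law of $(\varepsilon_1,\dots,\varepsilon_n)$ with these properties is called an admissible noise distribution (for the parameter $\sigma$). An estimator is a (measurable) map assigning to the sample $\mathcal D_n$ a function $\{0,1\}^d\to\mathbb R$; it may not depend on the unknown $f$ or on the noise distribution. Risk. $R(\hat f,f)=\mathbb E_{\mathcal D_n}[\|\hat f-f\|_2^2]$, where $\|g\|_2^2=2^{-d}\sum_{x\in\{0,1\}^d}g(x)^2$ and the expectation is over the sample generated from $f$ and the noise distribution. Influences. For $x\in\{0,1\}^d$, $i\in[d]=\{1,\dots,d\}$, $b\in\{0,1\}$, let $x^{i\to b}$ be $x$ with $i$-th coordinate replaced by $b$, and $\Delta_i f(x)=f(x^{i\to1})-f(x^{i\to0})$. With $X\sim\mu$: $I_i(f)=\mathbb E[|\Delta_i f(X)|]$, $I(f)=\sum_{i=1}^d I_i(f)$, and $I^{(2)}(f)=\sum_{i=1}^d\mathbb E[(\Delta_i f(X))^2]$. Class. $f$ is monotone if $x\le y$ coordinatewise implies $f(x)\le f(y)$. For $K>0$, $\mathcal F_K=\{f:\{0,1\}^d\to[0,1]\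 :\ f\text{ monotone},\ I(f)\le K\}$. Fourier thresholding estimator with constants $\gamma>2\log3$, $c_0>0$. For $S\subseteq[d]$ put $\chi_S(x)=\prod_{i\in S}(2x_i-1)$, $\chi_\emptyset\equiv1$. Step 0: split the sample into the first $n_1=\lfloor n/2\rfloor$ observations and the remaining $n_2=n-n_1$. Step 1: set $d_0=\max\big(\big\lceil\sqrt{(\log n-c_0\sqrt{\log n})_+/\gamma}\,\big\rceil,1\big)$ and $\delta=e^{-\gamma d_0}$. From the first part compute, for $i\in[d]$, $\hat I_i=\bar Y_{i,1}-\bar Y_{i,0}$, where $\bar Y_{i,b}=\big(\sum_{j\le n_1}Y_j\mathbf 1_{\{X_{j,i}=b\}}\big)/\big(\sum_{j\le n_1}\mathbf 1_{\{X_{j,i}=b\}}\big)$ (an arbitrary fixed value, e.g. $0$, if the denominator vanishes), and $\hat J=\{i\in[d]:\hat I_i\ge\delta/2\}$. Step 2: let $\hat{\mathcal S}=\{S\subseteq\hat J:|S|\le d_0\}$ and, from the second part, compute $\tilde f(S)=\frac1{n_2}\sum_{j=n_1+1}^nY_j\chi_S(X_j)$ for $S\in\hat{\mathcal S}$. Step 3: output $\hat f_n(x)=\max\big(0,\min\big(\sum_{S\in\hat{\mathcal S}}\tilde f(S)\chi_S(x),1\big)\big)$. *)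

(* Defs.v *)
From HB Require Import structures.
From mathcomp Require Import all_boot all_order all_algebra.
From mathcomp Require Import all_classical all_reals all_analysis.
Set Implicit Arguments.
Unset Strict Implicit.
Unset Printing Implicit Defensive.
Import Order.TTheory GRing.Theory Num.Theory.
Import numFieldNormedType.Exports.
Local Open Scope classical_set_scope.
Local Open Scope ring_scope.

Notation cube d := (d.-tuple bool).

Section Cube.
Context {R : realType} {d : nat}.
Implicit Types (f g : cube d -> R) (x y : cube d) (i : 'I_d).

(* Expectation of [g] under the uniform measure on the cube. *)
Definition cube_mean g : R := (2 ^+ d)^-1 * \sum_x g x.

Definition l2normsq g : R := cube_mean (fun x => g x ^+ 2).

Definition set_coord x i (b : bool) : cube d :=
  [tuple if k == i then b else tnth x k | k < d].

Definition cube_diff i f x : R :=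
  f (set_coord x i true) - f (set_coord x i false).

Definition influence i f : R := cube_mean (fun x => `|cube_diff i f x|).

Definition total_influence f : R := \sum_(i < d) influence i f.

Definition total_influence2 f : R :=
  \sum_(i < d) cube_mean (fun x => cube_diff i f x ^+ 2).

Definition cube_le x y : Prop := forall i, tnth x i ==> tnth y i.

Definition cube_monotone f : Prop := forall x y, cube_le x y -> f x <= f y.

Definition class_K (K : R) : set (cube d -> R) :=
  [set f | [/\ forall x, 0 <= f x <= 1, cube_monotone f
             & total_influence f <= K]].

Definition class_KB (K B : R) : set (cube d -> R) :=
  [set f | class_K K f /\ total_influence2 f <= B].

Definition walsh (S : {set 'I_d}) x : R :=
  \prod_(i in S) (2 * (tnth x i)%:R - 1).

End Cube.

(* The law of n i.i.d. uniform points of the cube, i.e. the uniform law on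
   [n.-tuple (cube d)]; see [design_law_iid]. *)
Section DesignLaw.
Context (R : realType) (d n : nat).

Definition design_scale : {nonneg R} := ((2 ^+ (d * n))^-1)%:nng.

Definition design_law : set (n.-tuple (cube d)) -> \bar R :=
  mscale design_scale (@counting (n.-tuple (cube d)) R).

HB.instance Definition _ := Measure.on design_law.

Lemma design_lawE (A : {set n.-tuple (cube d)}) :
  design_law [set` A] = ((2 ^+ (d * n))^-1 * #|A|%:R)%:E.
Proof.
have finA : finite_set [set` A] by exact: finite_finset.
have cardA : size (finmap.enum_fset (fset_set [set` A])) = #|A|.
  rewrite cardE; apply/perm_size/uniq_perm => [||x]; rewrite ?enum_uniq//.
  by rewrite mem_enum in_fset_set//; apply/idP/idP; rewrite inE.
have -> : design_law [set` A] = (((2 ^+ (d * n))^-1)%:E *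
    @counting (n.-tuple (cube d)) R [set` A])%E by [].
by rewrite /counting asboolT// cardA.
Qed.

Let design_law_setT : design_law setT = 1%E.
Proof.
rewrite (_ : setT = [set` [set: n.-tuple (cube d)]%SET]); last first.
  by apply/seteqP; split => x //= _; rewrite inE.
rewrite design_lawE cardsT card_tuple card_tuple card_bool -expnM natrX.
by rewrite mulVf// expf_neq0// pnatr_eq0.
Qed.

HB.instance Definition _ :=
  @Measure_isProbability.Build _ _ R design_law design_law_setT.

Lemma design_law_iid (A : 'I_n -> {set cube d}) :
  design_law [set x | forall j, tnth x j \in A j] =
  (\prod_(j < n) ((2 ^+ d)^-1 * #|A j|%:R))%:E.
Proof.
rewrite (_ : [set x | _] =
  [set` [set x : n.-tuple (cube d) | [forall j, tnth x j \in A j]]%SET]).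
  rewrite design_lawE big_split/= prodr_const card_ord -natr_prod.
  congr (_ * _%:R)%:E; first by rewrite exprVn exprM.
  have -> : (\prod_(j < n) #|A j|)%N = #|family A|.
    by rewrite card_family foldrE big_map big_enum.
  rewrite -[RHS]cardsE -(on_card_preimset
    (onW_bij _ (Bijective (@finfun_of_tupleK _ n) (@tuple_of_finfunK _ n)))).
  apply: eq_card => x; rewrite !inE.
  apply/forallP/familyP => xA j; first by rewrite ffunE.
  by have := xA j; rewrite ffunE.
by apply/seteqP; split => x /=; rewrite inE => /forallP.
Qed.

End DesignLaw.
Arguments design_law : clear implicits.

Definition independent_family {dT} {T : measurableType dT} {R : realType}
    (P : probability T R) n (Z : 'I_n -> T -> R) : Prop :=
  forall (J : {set 'I_n}) (B : 'I_n -> set R),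
    (forall j, measurable (B j)) ->
    P [set w | forall j, j \in J -> B j (Z j w)] =
    (\prod_(j in J) P (Z j @^-1` B j))%E.

(* Noise distributions are joint laws of (e_1, ..., e_n) on R^n. *)
Definition admissible_noise {R : realType} n (sigma : R)
    (Q : probability (n.-tuple R) R) : Prop :=
  let noise (j : 'I_n) := fun e : n.-tuple R => tnth e j in
  [/\ independent_family Q noise,
      forall j, ('E_Q[noise j] = 0)%E
    & forall j (t : R),
        ('M_Q (noise j) t <= (expR (sigma ^+ 2 * t ^+ 2 / 2))%:E)%E].

Notation sample R d n := (n.-tuple (cube d * R)%type).

Definition regression_sample {R : realType} {d n} (f : cube d -> R)
    (w : n.-tuple (cube d) * n.-tuple R) : sample R d n :=
  [tuple (tnth w.1 j, f (tnth w.1 j) + tnth w.2 j) | j < n].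

Definition is_estimator {R : realType} {d n}
    (est : sample R d n -> cube d -> R) : Prop :=
  forall x, measurable_fun [set: sample R d n] (fun D => est D x).

(* The X_j are independent of the noise, whence the product measure. *)
Definition risk {R : realType} {d n} (Q : probability (n.-tuple R) R)
    (est : sample R d n -> cube d -> R) (f : cube d -> R) : \bar R :=
  let loss w : R := l2normsq (fun x => est (regression_sample f w) x - f x) in
  ('E_(design_law R d n \x Q)[loss])%E.

Section FourierThresholding.
Context {R : realType} {d n : nat}.
Variables (gamma c0 : R).
Implicit Types (D : sample R d n) (i : 'I_d) (S : {set 'I_d}).

Definition degree_cutoff : nat :=
  let L : R := ln n%:R in
  let k : int := Num.ceil (Num.sqrt
                   (Num.max (L - c0 * Num.sqrt L) 0 / gamma)) in
  maxn `|k|%N 1.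

Definition influence_cutoff : R := expR (- (gamma * degree_cutoff%:R)).

Definition obsX D (j : 'I_n) : cube d := (tnth D j).1.
Definition obsY D (j : 'I_n) : R := (tnth D j).2.

(* The first part of the sample consists of the indices j < n./2.
   When no such j has X_(j,i) = b this is 0 / 0 = 0. *)
Definition cond_mean D i (b : bool) : R :=
  (\sum_(j < n | (j < n./2)%N && (tnth (obsX D j) i == b)) obsY D j) /
  #|[set j : 'I_n | (j < n./2)%N && (tnth (obsX D j) i == b)]|%:R.

Definition influence_est D i : R := cond_mean D i true - cond_mean D i false.

Definition selected_coords D : {set 'I_d} :=
  [set i | influence_cutoff / 2 <= influence_est D i].

Definition fourier_coef_est D S : R :=
  (n - n./2)%:R^-1 *
  \sum_(j < n | (n./2 <= j)%N) (obsY D j * walsh S (obsX D j)).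

Definition fourier_estimator D (x : cube d) : R :=
  Num.max 0 (Num.min
    (\sum_(S : {set 'I_d} | (S \subset selected_coords D) &&
                            (#|S| <= degree_cutoff)%N)
       (fourier_coef_est D S * walsh S x)) 1).

End FourierThresholding.

(* Main.v *)
(* Upper bound. Outside an exponentially small event every estimated influence
   is within delta/4 of the true one, so the selected family of frequencies lies
   in a deterministic family of at most delta^-d0 e^(4K) sets, each coefficient
   of which is estimated with mean squared error O(1/n). The frequencies left out
   have size > d0, and weigh at most I2/(4 d0), or contain a coordinate of
   influence at most delta; by hypercontractivity the weight of the latter is at
   most 3^-d0 I(f) as soon as delta = 81^-d0. All probabilistic estimates come
   from one exponential moment bound, applied under a pointwise majorant of the
   loss, so that neither conditioning nor measurability of the estimator enters.

   Lower bound. On the first 2m coordinates, with m of order log n, the functions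
   equal to 0 below the middle layer, to a above it, and arbitrary on it are
   monotone. Without any noise, a sample of n points leaves half of the layer
   unseen, where a uniformly random function cannot be guessed: the risk is at
   least of order a^2/sqrt m, whereas I and I2 are of order a sqrt m and
   a^2 sqrt m. *)
Require Import Defs.
From mathcomp Require Import all_boot all_order all_algebra.
From mathcomp Require Import all_classical all_reals all_analysis.
From mathcomp Require Import measurable_realfun zify ring lra.
Set Implicit Arguments.
Unset Strict Implicit.
Unset Printing Implicit Defensive.
Import Order.TTheory GRing.Theory Num.Theory.
Import numFieldNormedType.Exports.
Local Open Scope classical_set_scope.
Local Open Scope ring_scope.

(** * Fourier analysis on the cube *)

Lemma tuple_sum_prod (R : realType) (T : finType) n (G : 'I_n -> T -> R) :
  \sum_(x : n.-tuple T) \prod_j G j (tnth x j) = \prod_j \sum_t G j t.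
Proof.
rewrite bigA_distr_bigA/=.
rewrite (reindex (fun f : {ffun 'I_n -> T} => [tuple f j | j < n])) /=; last first.
  exists (fun x : n.-tuple T => [ffun j => tnth x j]) => [f _|x _].
    by apply/ffunP => j; rewrite ffunE tnth_mktuple.
  by apply: eq_from_tnth => j; rewrite tnth_mktuple ffunE.
by apply: eq_bigr => f _; apply: eq_bigr => j _; rewrite tnth_mktuple.
Qed.

Section CubeMean.
Context {R : realType} {d : nat}.
Implicit Types (f g h : cube d -> R) (x y : cube d) (i : 'I_d) (c : R).

Lemma cube_scale_gt0 : 0 < (2 ^+ d)^-1 :> R.
Proof. by rewrite invr_gt0 exprn_gt0. Qed.

Lemma eq_cube_mean f g : f =1 g -> cube_mean f = cube_mean g.
Proof. by move=> fg; congr (_ * _); apply: eq_bigr => x _. Qed.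

Lemma cube_meanD f g :
  cube_mean (fun x => f x + g x) = cube_mean f + cube_mean g.
Proof. by rewrite /cube_mean big_split mulrDr. Qed.

Lemma cube_meanZ c f : cube_mean (fun x => c * f x) = c * cube_mean f.
Proof. by rewrite /cube_mean -mulr_sumr mulrCA. Qed.

Lemma cube_meanB f g :
  cube_mean (fun x => f x - g x) = cube_mean f - cube_mean g.
Proof.
rewrite -[X in _ - X]mul1r -mulNr -cube_meanZ -cube_meanD.
by apply: eq_cube_mean => x; rewrite mulN1r.
Qed.

Lemma cube_mean_sum I (r : seq I) (P : pred I) (F : I -> cube d -> R) :
  cube_mean (fun x => \sum_(k <- r | P k) F k x) =
  \sum_(k <- r | P k) cube_mean (F k).
Proof. by rewrite /cube_mean exchange_big mulr_sumr. Qed.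

Lemma cube_mean_cst c : cube_mean (fun _ : cube d => c) = c.
Proof.
rewrite /cube_mean sumr_const card_tuple card_bool -[X in _ * X]mulr_natl.
by rewrite natrX mulrA mulVf ?mul1r// expf_neq0// pnatr_eq0.
Qed.

Lemma ler_cube_mean f g : (forall x, f x <= g x) -> cube_mean f <= cube_mean g.
Proof.
move=> fg; apply: ler_wpM2l; first exact/ltW/cube_scale_gt0.
by apply: ler_sum => x _.
Qed.

Lemma cube_mean_ge0 f : (forall x, 0 <= f x) -> 0 <= cube_mean f.
Proof. by move=> f0; rewrite -[leLHS](cube_mean_cst 0); apply: ler_cube_mean. Qed.

Lemma cube_mean_Cauchy_Schwarz f g :
  cube_mean (fun x => f x * g x) ^+ 2 <=
  cube_mean (fun x => f x ^+ 2) * cube_mean (fun x => g x ^+ 2).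
Proof.
suff CS : (\sum_x f x * g x) ^+ 2 <= (\sum_x f x ^+ 2) * (\sum_x g x ^+ 2).
  by rewrite /cube_mean exprMn [leRHS]mulrACA -expr2 ler_wpM2l// sqr_ge0.
rewrite -subr_ge0 -(@pmulr_rge0 _ 2)//.
have -> : 2 * ((\sum_x f x ^+ 2) * (\sum_x g x ^+ 2) - (\sum_x f x * g x) ^+ 2)
    = \sum_x \sum_y (f x * g y - f y * g x) ^+ 2.
  under [RHS]eq_bigr => x _.
    under eq_bigr => y _.
      rewrite (_ : _ ^+ 2 = f x ^+ 2 * g y ^+ 2 +
        (g x ^+ 2 * f y ^+ 2 - (2 * (f x * g x)) * (f y * g y))); last by ring.
      over.
    rewrite big_split/= big_split/= sumrN -!mulr_sumr.
    over.
  rewrite big_split/= big_split/= sumrN -!mulr_suml -mulr_sumr; ring.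
by apply: sumr_ge0 => x _; apply: sumr_ge0 => y _; exact: sqr_ge0.
Qed.

Definition flip i x : cube d :=
  [tuple if k == i then ~~ tnth x k else tnth x k | k < d].

Lemma flipK i : involutive (flip i).
Proof.
move=> x; apply: eq_from_tnth => k; rewrite !tnth_mktuple.
by case: eqP => // _; rewrite negbK.
Qed.

Lemma cube_mean_flip i f : cube_mean (fun x => f (flip i x)) = cube_mean f.
Proof.
rewrite /cube_mean [in RHS](reindex_inj (inv_inj (flipK i))).
by congr (_ * _).
Qed.

Lemma cube_mean_odd i f : (forall x, f (flip i x) = - f x) -> cube_mean f = 0.
Proof.
move=> fo; suff : cube_mean f = - cube_mean f by lra.
rewrite -[LHS](cube_mean_flip i) -mulN1r -cube_meanZ.
by apply: eq_cube_mean => x; rewrite fo mulN1r.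
Qed.

End CubeMean.

Section Walsh.
Context {R : realType} {d : nat}.
Implicit Types (f g h : cube d -> R) (x y : cube d) (i : 'I_d).
Implicit Types (S T J : {set 'I_d}).

Lemma big_subsets_setD1 i J (F : {set 'I_d} -> R) : i \in J ->
  \sum_(S : {set 'I_d} | S \subset J) F S =
  \sum_(S : {set 'I_d} | S \subset J :\ i) (F S + F (i |: S)).
Proof.
move=> iJ; rewrite (bigID (fun S => i \in S))/= addrC big_split/=; congr (_ + _).
  by apply: eq_bigl => S; rewrite subsetD1.
rewrite (reindex_onto (fun S => i |: S) (fun S => S :\ i))/=; last first.
  by move=> S /andP[_ iS]; rewrite finset.setD1K.
apply: eq_bigl => S; rewrite finset.subUset finset.sub1set iJ finset.setU11 subsetD1/= andbT.
have [iS|iS] := boolP (i \in S); last by rewrite finset.setU1K// eqxx !andbT.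
rewrite andbF; apply/andP => -[_ /eqP eS].
by move: iS; rewrite -eS !inE eqxx.
Qed.

Lemma walsh_sqr S x : walsh S x ^+ 2 = 1 :> R.
Proof.
rewrite /walsh -prodrXl big1// => i _.
by case: (tnth x i); rewrite /=; ring.
Qed.

Lemma norm_walsh S x : `|walsh S x| = 1 :> R.
Proof.
by apply/eqP; rewrite -(@eqrXn2 _ 2)// real_normK ?num_real// walsh_sqr expr1n.
Qed.

Lemma walsh_set0 x : walsh finset.set0 x = 1 :> R.
Proof. by rewrite /walsh big_set0. Qed.

Lemma walshU1 i S x : i \notin S ->
  walsh (i |: S) x = walsh [set i]%SET x * walsh S x :> R.
Proof. by move=> iS; rewrite /walsh big_setU1//= big_set1. Qed.

Lemma walsh_flip_notin i S x : i \notin S ->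
  walsh S (flip i x) = walsh S x :> R.
Proof.
move=> iS; apply: eq_bigr => k kS; rewrite tnth_mktuple.
by case: eqP kS iS => // -> ->.
Qed.

Lemma walsh_flip_in i S x : i \in S -> walsh S (flip i x) = - walsh S x :> R.
Proof.
move=> iS; rewrite -(finset.setD1K iS) !walshU1 ?finset.setD11//
  [walsh (_ :\ _) _]walsh_flip_notin ?finset.setD11//.
rewrite -mulNr; congr (_ * _); rewrite /walsh !big_set1 tnth_mktuple eqxx.
by case: (tnth x i) => /=; ring.
Qed.

Lemma walsh_orthonormal S T :
  cube_mean (fun x => walsh S x * walsh T x) = (S == T)%:R :> R.
Proof.
have [->|ST] := eqVneq S T.
  rewrite -[RHS](@cube_mean_cst R d _); apply: eq_cube_mean => x.
  by rewrite -expr2 walsh_sqr.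
have [i iST] : exists i, (i \in S) != (i \in T).
  apply/existsP; apply: contraNT ST => /existsPn iST; apply/eqP/setP => i.
  by apply/eqP; have := iST i; rewrite negbK.
apply: (cube_mean_odd (i := i)) => x; move: iST.
case: (boolP (i \in S)) => iS; case: (boolP (i \in T)) => iT // _.
  by rewrite (walsh_flip_in x iS) (walsh_flip_notin x iT) mulNr.
by rewrite (walsh_flip_notin x iS) (walsh_flip_in x iT) mulrN.
Qed.

Lemma sum_subsets_prod J (c : 'I_d -> R) :
  \sum_(S : {set 'I_d} | S \subset J) \prod_(i in S) c i = \prod_(i in J) (1 + c i).
Proof.
have [n] := ubnP #|J|; elim: n J => // n IH J.
have [->|[i iJ]] := set_0Vmem J.
  move=> _; rewrite big_set0 (bigD1 finset.set0)//= big_set0 big1 ?addr0// => S.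
  by rewrite finset.subset0 => /andP[->].
rewrite (cardsD1 i J) iJ ltnS => JD.
rewrite (big_subsets_setD1 _ iJ) (big_setD1 i iJ)/= -IH// mulrDl mul1r.
rewrite big_split/=; congr (_ + _); rewrite mulr_sumr; apply: eq_bigr => S.
by rewrite subsetD1 => /andP[_ iS]; rewrite big_setU1.
Qed.

Lemma sum_walsh_mul x y :
  \sum_S walsh S x * walsh S y = (x == y)%:R * 2 ^+ d :> R.
Proof.
pose c i : R := (2 * (tnth x i)%:R - 1) * (2 * (tnth y i)%:R - 1).
have -> : \sum_S walsh S x * walsh S y = \prod_i (1 + c i).
  have -> : \prod_i (1 + c i) = \prod_(i in [set: 'I_d]%SET) (1 + c i).
    by apply: eq_bigl => i; rewrite inE.
  rewrite -sum_subsets_prod; apply: eq_big => S; first by rewrite finset.subsetT.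
  by rewrite /walsh -big_split.
have [xy|xy] := eqVneq x y.
  rewrite mul1r (eq_bigr (fun=> 2)) ?prodr_const ?card_ord// => i _.
  by rewrite /c xy; case: (tnth y i) => /=; ring.
have [i ixy] : exists i, tnth x i != tnth y i.
  apply/existsP; apply: contraNT xy => /existsPn ixy.
  by apply/eqP/eq_from_tnth => i; apply/eqP; have := ixy i; rewrite negbK.
rewrite mul0r; apply/eqP/prodf_eq0; exists i => //; rewrite /c.
by move: ixy; case: (tnth x i); case: (tnth y i) => //= _; apply/eqP; ring.
Qed.

Definition fourier f S : R := cube_mean (fun x => f x * walsh S x).

Lemma fourier_inversion f x : f x = \sum_S fourier f S * walsh S x.
Proof.
rewrite /fourier /cube_mean.
under eq_bigr do rewrite -mulrA mulr_suml; rewrite -mulr_sumr exchange_big/=.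
under eq_bigr => y _.
  under eq_bigr do rewrite -mulrA; rewrite -mulr_sumr sum_walsh_mul; over.
rewrite (bigD1 x)//= big1 ?addr0; last first.
  by move=> y /negPf ->; rewrite mul0r mulr0.
by rewrite eqxx mul1r mulrCA mulVf ?mulr1// expf_neq0.
Qed.

Lemma cube_mean_walsh_sqr (a : {set 'I_d} -> R) :
  cube_mean (fun x => (\sum_S a S * walsh S x) ^+ 2) = \sum_S a S ^+ 2.
Proof.
under eq_cube_mean => x.
  rewrite expr2 mulr_suml.
  under eq_bigr => S _ do rewrite mulr_sumr.
  over.
rewrite cube_mean_sum; apply: eq_bigr => S _.
rewrite cube_mean_sum.
under eq_bigr => T _.
  under eq_cube_mean => x do rewrite mulrACA.
  rewrite cube_meanZ walsh_orthonormal; over.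
rewrite (bigD1 S)//= eqxx mulr1 big1 ?addr0 ?expr2// => T.
by rewrite eq_sym => /negPf->; rewrite mulr0.
Qed.

Lemma parseval f : l2normsq f = \sum_S fourier f S ^+ 2.
Proof.
rewrite -cube_mean_walsh_sqr; apply: eq_cube_mean => x.
by rewrite -fourier_inversion.
Qed.

Lemma fourier_walsh_sum (a : {set 'I_d} -> R) T :
  fourier (fun x => \sum_S a S * walsh S x) T = a T.
Proof.
rewrite /fourier.
under eq_cube_mean do rewrite mulr_suml; rewrite cube_mean_sum.
under eq_bigr => S _.
  under eq_cube_mean => x do rewrite -mulrA.
  rewrite cube_meanZ walsh_orthonormal; over.
by rewrite (bigD1 T)//= eqxx mulr1 big1 ?addr0// => S /negPf->; rewrite mulr0.
Qed.

Lemma fourierB f g S :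
  fourier (fun x => f x - g x) S = fourier f S - fourier g S.
Proof. by rewrite /fourier -cube_meanB; apply: eq_cube_mean => x; rewrite mulrBl. Qed.

Lemma l2normsq_walsh_sum (a : {set 'I_d} -> R) f :
  l2normsq (fun x => \sum_S a S * walsh S x - f x) =
  \sum_S (a S - fourier f S) ^+ 2.
Proof.
rewrite parseval; apply: eq_bigr => S _.
by rewrite fourierB fourier_walsh_sum.
Qed.

(* (2,4)-hypercontractivity. Splitting off a coordinate as p + u q, the fourth
   moment is at most P^2 + 6PQ + Q^2 <= (P + 3Q)^2. *)
Lemma bonami J (a : {set 'I_d} -> R) :
  cube_mean (fun x => (\sum_(S : {set 'I_d} | S \subset J) a S * walsh S x) ^+ 4) <=
  (\sum_(S : {set 'I_d} | S \subset J) 3 ^+ #|S| * a S ^+ 2) ^+ 2.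
Proof.
have [n] := ubnP #|J|; elim: n J a => // n IH J a.
have [->|[i iJ]] := set_0Vmem J.
  move=> _; rewrite (bigD1 finset.set0)//= big1 ?addr0; last first.
    by move=> S; rewrite finset.subset0 => /andP[->].
  rewrite cards0 expr0 mul1r -exprM -[leRHS](@cube_mean_cst R d _).
  apply: ler_cube_mean => x; rewrite (bigD1 finset.set0)//= big1; last first.
    by move=> S; rewrite finset.subset0 => /andP[->].
  by rewrite walsh_set0 mulr1 addr0.
rewrite (cardsD1 i J) iJ ltnS => JD.
pose p x := \sum_(S : {set 'I_d} | S \subset J :\ i) a S * walsh S x.
pose q x := \sum_(S : {set 'I_d} | S \subset J :\ i) a (i |: S) * walsh S x.
pose P := \sum_(S : {set 'I_d} | S \subset J :\ i) 3 ^+ #|S| * a S ^+ 2.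
pose Q := \sum_(S : {set 'I_d} | S \subset J :\ i) 3 ^+ #|S| * a (i |: S) ^+ 2.
have P0 : 0 <= P by apply: sumr_ge0 => S _; rewrite mulr_ge0 ?sqr_ge0 ?exprn_ge0.
have Q0 : 0 <= Q by apply: sumr_ge0 => S _; rewrite mulr_ge0 ?sqr_ge0 ?exprn_ge0.
have p4 : cube_mean (fun x => p x ^+ 4) <= P ^+ 2 by exact: IH.
have q4 : cube_mean (fun x => q x ^+ 4) <= Q ^+ 2.
  exact: (IH _ (fun S => a (i |: S))).
have pq : cube_mean (fun x => p x ^+ 2 * q x ^+ 2) <= P * Q.
  have pq0 : 0 <= cube_mean (fun x => p x ^+ 2 * q x ^+ 2).
    by apply: cube_mean_ge0 => x; apply: mulr_ge0; exact: sqr_ge0.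
  rewrite -ler_sqr ?nnegrE//; last exact: mulr_ge0.
  apply: le_trans (cube_mean_Cauchy_Schwarz _ _) _; rewrite exprMn.
  under eq_cube_mean do rewrite -exprM.
  under [X in _ * X <= _]eq_cube_mean do rewrite -exprM.
  apply: ler_pM => //; apply: cube_mean_ge0 => x; first by rewrite (exprM _ 2 2) sqr_ge0.
  by rewrite (exprM _ 2 2) sqr_ge0.
have -> : \sum_(S : {set 'I_d} | S \subset J) 3 ^+ #|S| * a S ^+ 2 = P + 3 * Q.
  rewrite (big_subsets_setD1 _ iJ) big_split/=; congr (_ + _).
  rewrite mulr_sumr; apply: eq_bigr => S; rewrite subsetD1 => /andP[_ iS].
  by rewrite cardsU1 iS add1n exprS mulrA.
pose u x : R := walsh [set i]%SET x.
have sumE x : \sum_(S : {set 'I_d} | S \subset J) a S * walsh S x = p x + u x * q x.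
  rewrite (big_subsets_setD1 _ iJ) big_split/=; congr (_ + _).
  rewrite mulr_sumr; apply: eq_bigr => S; rewrite subsetD1 => /andP[_ iS].
  by rewrite walshU1// mulrCA.
have pf x : p (flip i x) = p x.
  apply: eq_bigr => S; rewrite subsetD1 => /andP[_ iS].
  by rewrite walsh_flip_notin.
have qf x : q (flip i x) = q x.
  apply: eq_bigr => S; rewrite subsetD1 => /andP[_ iS].
  by rewrite walsh_flip_notin.
have uf x : u (flip i x) = - u x by rewrite /u walsh_flip_in// inE.
have u2 x : u x ^+ 2 = 1 by exact: walsh_sqr.
have -> : cube_mean (fun x => (\sum_(S : {set 'I_d} | S \subset J) a S * walsh S x) ^+ 4) =
   cube_mean (fun x => p x ^+ 4) + 6 * cube_mean (fun x => p x ^+ 2 * q x ^+ 2)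
   + cube_mean (fun x => q x ^+ 4) +
   cube_mean (fun x => u x * (4 * p x ^+ 3 * q x + 4 * p x * q x ^+ 3)).
  rewrite -cube_meanZ -!cube_meanD; apply: eq_cube_mean => x; rewrite sumE.
  have u3 : u x ^+ 3 = u x by rewrite exprS u2 mulr1.
  have u4 : u x ^+ 4 = 1 by rewrite (exprM _ 2 2) u2 expr1n.
  rewrite (_ : _ ^+ 4 = p x ^+ 4 + 4 * p x ^+ 3 * q x * u x +
     6 * p x ^+ 2 * q x ^+ 2 * u x ^+ 2 + 4 * p x * q x ^+ 3 * u x ^+ 3
     + q x ^+ 4 * u x ^+ 4); last by ring.
  by rewrite u2 u3 u4; ring.
rewrite (cube_mean_odd (i := i) (f := fun x => u x * _)); last first.
  by move=> x; rewrite pf qf uf mulNr.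
rewrite addr0; apply: (@le_trans _ _ (P ^+ 2 + 6 * (P * Q) + Q ^+ 2)).
  by apply: lerD => //; apply: lerD => //; apply: ler_wpM2l.
rewrite -subr_ge0 (_ : _ - _ = 8 * (Q ^+ 2)); last by ring.
by rewrite mulr_ge0// sqr_ge0.
Qed.

End Walsh.

(** * Exponential moments of the regression sample *)

Section Integration.
Context {dT} {T : measurableType dT} {R : realType} (mu : {measure set T -> \bar R}).
Local Open Scope ereal_scope.

(* No measurability is needed: both integrals are suprema over simple functions. *)
Lemma le_integral_nonmeasurable (f g : T -> \bar R) :
  (forall x, 0 <= f x) -> (forall x, f x <= g x) ->
  \int[mu]_x f x <= \int[mu]_x g x.
Proof.
move=> f0 fg; have g0 x : 0 <= g x by exact: le_trans (f0 x) (fg x).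
rewrite !ge0_integralTE//; apply: le_ereal_sup => _ [h hf <-].
by exists h => // x; exact: le_trans (hf x) (fg x).
Qed.

Import HBNNSimple.

Lemma ge0_integral_mul_comp_le (Phi Z : T -> R) (c : R) :
  measurable_fun setT Phi -> (forall x, 0 <= Phi x)%R -> measurable_fun setT Z ->
  (0 <= c)%R ->
  (forall B : set R, measurable B ->
    \int[mu]_x (Phi x * \1_B (Z x))%:E <= c%:E * mu (Z @^-1` B)) ->
  forall g : R -> R, measurable_fun [set: R] g -> (forall r, 0 <= g r)%R ->
  \int[mu]_x (Phi x * g (Z x))%:E <= c%:E * \int[mu]_x (g (Z x))%:E.
Proof.
move=> mPhi Phi0 mZ c0 H g mg g0.
have mEg : measurable_fun [set: R] (fun r => (g r)%:E) by exact/measurable_EFinP.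
pose h := nnsfun_approx measurableT mEg.
have hnd x : {homo (fun n => h n x) : m n / (m <= n)%N >-> (m <= n)%R}.
  by move=> m n mn; exact/lefP/nd_nnsfun_approx.
have hg x : (fun n => (h n x)%:E) @ \oo --> (g x)%:E.
  by apply: (@cvg_nnsfun_approx _ _ _ _ measurableT _ mEg) => // y _; rewrite lee_fin.
have mh n : measurable_fun setT (fun x => h n (Z x)).
  exact: measurableT_comp.
have mPh n : measurable_fun setT (fun x => Phi x * h n (Z x))%R.
  exact: measurable_funM.
have -> : \int[mu]_x (Phi x * g (Z x))%:E =
    limn (fun n => \int[mu]_x (Phi x * h n (Z x))%:E).
  rewrite -monotone_convergence//.
  - apply: eq_integral => x _; apply/esym/cvg_lim => //.
    rewrite EFinM; under eq_fun do rewrite EFinM; exact: cvgeZl.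
  - by move=> n; exact/measurable_EFinP.
  - by move=> n x _; rewrite lee_fin mulr_ge0.
  - by move=> x _ m n mn; rewrite lee_fin ler_wpM2l// hnd.
apply: lime_le.
  apply: ereal_nondecreasing_is_cvgn => m n mn; apply: ge0_le_integral => //.
  - by move=> x _; rewrite lee_fin mulr_ge0.
  - exact/measurable_EFinP.
  - exact/measurable_EFinP.
  - by move=> x _; rewrite lee_fin ler_wpM2l// hnd.
apply: nearW => n.
apply: (@le_trans _ _ (c%:E * \int[mu]_x (h n (Z x))%:E)); last first.
  apply: lee_wpmul2l; first by rewrite lee_fin.
  apply: ge0_le_integral => //.
  - by move=> x _; rewrite lee_fin.
  - exact/measurable_EFinP.
  - by apply/measurable_EFinP; exact: measurableT_comp.
  - move=> x _; have nd : {homo (fun n => (h n (Z x))%:E) : a b / (a <= b)%N >-> a <= b}.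
      by move=> a b ab; rewrite lee_fin hnd.
    have /cvg_lim <-// := hg (Z x).
    rewrite (cvg_lim _ (ereal_nondecreasing_cvgn nd))//.
    by apply: ereal_sup_ubound; exists n.
pose u k r : R := (k * \1_(h n @^-1` [set k]) r)%R.
have u0 k r : (0 <= u k r)%R.
  rewrite /u indicE; have [|] := boolP (r \in _); last by rewrite mulr0.
  by rewrite inE/= => <-; rewrite mulr1.
have mu_ k : measurable_fun setT (fun x => u k (Z x)).
  by apply: measurable_funM => //; apply: measurableT_comp => //.
pose s : seq R := finmap.enum_fset (fset_set (range (h n))).
have hE r : h n r = (\sum_(k <- s) u k r)%R.
  by rewrite fimfunE fsbig_finite.
under eq_integral do rewrite hE mulr_sumr -sumEFin.
rewrite ge0_integral_sum//; last 2 first.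
- by move=> k; apply/measurable_EFinP; exact: measurable_funM.
- by move=> k x _; rewrite lee_fin mulr_ge0.
under [in leRHS]eq_integral do rewrite hE -sumEFin.
rewrite ge0_integral_sum//; last 2 first.
- by move=> k; exact/measurable_EFinP.
- by move=> k x _; rewrite lee_fin.
rewrite ge0_sume_distrr; last by move=> k _; apply: integral_ge0 => x _; rewrite lee_fin.
apply: lee_sum => k _; have [k0|k0] := leP 0%R k; last first.
  rewrite !integral0_eq ?mule0// => x _.
  - by apply/congr1/eqP; rewrite eq_le u0 andbT /u indicE mulr_le0_ge0// ltW.
  - have -> : u k (Z x) = 0%R; last by rewrite mulr0.
    by apply/eqP; rewrite eq_le u0 andbT /u indicE mulr_le0_ge0// ltW.
pose B := h n @^-1` [set k].
have mB : measurable B by exact: measurable_funPTI.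
have mZB : measurable (Z @^-1` B) by rewrite -[_ @^-1` _]setTI; exact: mZ.
have mI : measurable_fun setT (fun x => \1_B (Z x) : R).
  exact: measurableT_comp.
have -> : \int[mu]_x (Phi x * u k (Z x))%:E =
    k%:E * \int[mu]_x (Phi x * \1_B (Z x))%:E.
  rewrite -ge0_integralZl//.
  - by apply: eq_integral => x _; rewrite -EFinM /u mulrCA.
  - by apply/measurable_EFinP; exact: measurable_funM.
  - by move=> x _; rewrite lee_fin mulr_ge0.
have -> : \int[mu]_x (u k (Z x))%:E = k%:E * mu (Z @^-1` B).
  rewrite -(setIT (Z @^-1` B)) -integral_indic// -ge0_integralZl//.
  exact/measurable_EFinP.
by rewrite muleCA lee_wpmul2l ?lee_fin// H.
Qed.

End Integration.

Section Noise.
Context {dT} {T : measurableType dT} {R : realType} (P : probability T R).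
Variables (n : nat) (Z : 'I_n -> T -> R).
Hypotheses (mZ : forall j, measurable_fun setT (Z j)) (indepZ : independent_family P Z).
Local Open Scope ereal_scope.

Lemma measurable_prod_comp (g : 'I_n -> R -> R) (J : {set 'I_n}) :
  (forall j, measurable_fun [set: R] (g j)) ->
  measurable_fun setT (fun x => \prod_(j in J) g j (Z j x))%R.
Proof.
move=> mg.
under eq_fun do rewrite big_mkcond/=.
apply: measurable_prod => j _; case: (j \in J) => //.
exact: measurableT_comp.
Qed.

Lemma independent_integral_prod_le (g : 'I_n -> R -> R) (b : 'I_n -> R) :
  (forall j, measurable_fun [set: R] (g j)) -> (forall j r, 0 <= g j r)%R ->
  (forall j, 0 <= b j)%R ->
  (forall j, \int[P]_x (g j (Z j x))%:E <= (b j)%:E) ->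
  \int[P]_x (\prod_j g j (Z j x))%:E <= (\prod_j b j)%:E.
Proof.
move=> mg g0 b0 gb.
suff H (J K : {set 'I_n}) (B : 'I_n -> set R) : {in J, forall j, j \notin K} ->
    (forall j, measurable (B j)) ->
    \int[P]_x ((\prod_(j in J) g j (Z j x)) * \prod_(j in K) \1_(B j) (Z j x))%:E
    <= (\prod_(j in J) b j)%:E * \prod_(j in K) P (Z j @^-1` B j).
  have JK : {in [set: 'I_n]%SET, forall j, j \notin (finset.set0 : {set 'I_n})}.
    by move=> j _; rewrite inE.
  have := H _ _ (fun=> setT) JK (fun=> measurableT); rewrite big_set0 mule1.
  have -> : (\prod_(j in [set: 'I_n]%SET) b j = \prod_j b j)%R.
    by apply: eq_bigl => j; rewrite inE.
  apply: le_trans; rewrite le_eqVlt; apply/predU1l/eq_integral => x _.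
  rewrite big_set0 mulr1; congr (_%:E); apply: eq_bigl => j; by rewrite inE.
have [N] := ubnP #|J|; elim: N J K B => // N IH J K B.
have [->|[i iJ]] := set_0Vmem J.
  move=> _ _ mB; rewrite big_set0 mul1e -indepZ//.
  have mA : measurable [set w | forall j, j \in K -> B j (Z j w)].
    rewrite (_ : mkset _ = \bigcap_(j in [set` K]) (Z j @^-1` B j)).
      apply: fin_bigcap_measurable => // j _; rewrite -[_ @^-1` _]setTI.
      exact: mZ.
    by apply/seteqP; split.
  rewrite -(setIT (mkset _)) -integral_indic//.
  rewrite le_eqVlt; apply/predU1l/eq_integral => x _; rewrite big_set0 mul1r.
  congr (_%:E); rewrite indicE.
  have [|] := boolP (x \in _).
    by rewrite inE/= => xB; rewrite big1// => j jK; rewrite indicE mem_set//; exact: xB.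
  move=> xB; apply/eqP/prodf_eq0.
  have [j jK nB] : exists2 j, j \in K & ~ B j (Z j x).
    apply: contrapT => nex; move/negP: xB; apply; rewrite inE/= => j jK.
    by apply: contrapT => nB; apply: nex; exists j.
  by exists j => //; rewrite indicE memNset.
rewrite (cardsD1 i J) iJ ltnS => JN JK mB.
have iK := JK i iJ.
rewrite (big_setD1 i iJ)/=.
pose Phi x := (\prod_(j in J :\ i) g j (Z j x) * \prod_(j in K) \1_(B j) (Z j x))%R.
pose c : R := (\prod_(j in J :\ i) b j * fine (\prod_(j in K) P (Z j @^-1` B j)))%R.
have mPhi : measurable_fun setT Phi.
  apply: measurable_funM; first exact: measurable_prod_comp.
  by apply: (@measurable_prod_comp (fun j => \1_(B j))) => j; exact: measurable_indic.
have Phi0 x : (0 <= Phi x)%R by rewrite mulr_ge0 ?prodr_ge0.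
have PK0 : 0 <= \prod_(j in K) P (Z j @^-1` B j) by apply: prode_ge0 => j _.
have PKfin : \prod_(j in K) P (Z j @^-1` B j) \is a fin_num.
  rewrite prode_fin_num// => j _; rewrite fin_num_measure//.
  by rewrite -[_ @^-1` _]setTI; exact: mZ.
have c0 : (0 <= c)%R by rewrite mulr_ge0 ?prodr_ge0 ?fine_ge0.
have HC (C : set R) : measurable C ->
    \int[P]_x (Phi x * \1_C (Z i x))%:E <= c%:E * P (Z i @^-1` C).
  move=> mC; pose B' j := if j == i then C else B j.
  have B'K j : j \in K -> B' j = B j.
    by rewrite /B'; case: eqP => // ->; rewrite (negPf iK).
  have B'i : B' i = C by rewrite /B' eqxx.
  have JK' : {in (J :\ i)%SET, forall j, j \notin (i |: K)%SET}.
    by move=> j; rewrite !inE => /andP[/negPf-> jJ]; exact: JK.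
  have mB' j : measurable (B' j) by rewrite /B'; case: ifP.
  have := IH _ _ B' JN JK' mB'.
  have -> : \prod_(j in (i |: K)%SET) P (Z j @^-1` B' j) =
      P (Z i @^-1` C) * \prod_(j in K) P (Z j @^-1` B j).
    by rewrite big_setU1//= B'i; congr (_ * _); apply: eq_bigr => j jK; rewrite B'K.
  rewrite /c EFinM fineK// -muleA [X in _ <= _ * X -> _]muleC; apply: le_trans.
  rewrite le_eqVlt; apply/predU1l/eq_integral => x _; congr (_%:E).
  rewrite big_setU1//= B'i /Phi -mulrA; congr (_ * _)%R; rewrite mulrC; congr (_ * _)%R.
  by apply: eq_bigr => j jK; rewrite B'K.
have -> : \int[P]_x ((\prod_(j in J) g j (Z j x)) *
    \prod_(j in K) \1_(B j) (Z j x))%:E = \int[P]_x (Phi x * g i (Z i x))%:E.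
  apply: eq_integral => x _; congr (_%:E); rewrite (big_setD1 i iJ)/= /Phi.
  by rewrite mulrAC [RHS]mulrC mulrA mulrAC.
apply: le_trans (ge0_integral_mul_comp_le mPhi Phi0 (mZ i) c0 HC (mg i) (g0 i)) _.
apply: (@le_trans _ _ (c%:E * (b i)%:E)); first by rewrite lee_wpmul2l.
by rewrite EFinM /c EFinM fineK// muleAC [X in _ <= X * _]muleC.
Qed.

Lemma noise_mgf_le (sigma : R) (a : 'I_n -> R) :
  (forall j t, 'M_P (Z j) t <= (expR (sigma ^+ 2 * t ^+ 2 / 2))%:E) ->
  \int[P]_x (expR (\sum_j a j * Z j x))%:E <=
  (expR (sigma ^+ 2 / 2 * \sum_j a j ^+ 2))%:E.
Proof.
move=> H; under eq_integral do rewrite expR_sum.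
rewrite mulr_sumr expR_sum.
apply: (independent_integral_prod_le (g := fun j r => expR (a j * r))).
- by move=> j; apply: measurableT_comp => //; exact: measurable_funM.
- by move=> j r; exact: expR_ge0.
- by move=> j; exact: expR_ge0.
move=> j; have := H j (a j); rewrite /mmt_gen_fun unlock => /le_trans; 
under eq_integral do rewrite /= mulrC.
by apply; rewrite mulrAC.
Qed.

End Noise.

Section DesignLawIntegral.
Context {R : realType} {d n : nat}.
Local Open Scope ereal_scope.

Lemma measurable_cube_set (A : set (cube d)) : measurable A.
Proof.
suff H x : measurable [set x : cube d].
  rewrite (_ : A = \bigcup_(x in A) [set x]).
    by apply: fin_bigcup_measurable => //; exact: finite_finset.
  by apply/seteqP; split => [x Ax|x [y Ay ->]//]; exists x.
rewrite (_ : [set x] = \bigcap_(i in [set: 'I_d]) ((@tnth _ _ ^~ i) @^-1` [set tnth x i])).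
  apply: fin_bigcap_measurable => // i _; rewrite -[_ @^-1` _]setTI.
  exact: measurable_tnth.
apply/seteqP; split => [y -> //|y yx]; apply: eq_from_tnth => i.
exact: yx.
Qed.

Lemma measurable_design_set (A : set (n.-tuple (cube d))) : measurable A.
Proof.
suff H x : measurable [set x : n.-tuple (cube d)].
  rewrite (_ : A = \bigcup_(x in A) [set x]).
    by apply: fin_bigcup_measurable => //; exact: finite_finset.
  by apply/seteqP; split => [x Ax|x [y Ay ->]//]; exists x.
rewrite (_ : [set x] = \bigcap_(i in [set: 'I_n]) ((@tnth _ _ ^~ i) @^-1` [set tnth x i])).
  apply: fin_bigcap_measurable => // i _; rewrite -[_ @^-1` _]setTI.
  by apply: measurable_tnth => //; exact: measurable_cube_set.
apply/seteqP; split => [y -> //|y yx]; apply: eq_from_tnth => i.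
exact: yx.
Qed.

Lemma measurable_fun_design dT (T : measurableType dT) (g : n.-tuple (cube d) -> T) :
  measurable_fun setT g.
Proof. by move=> _ B mB; exact: measurable_design_set. Qed.

Lemma integral_design_law (g : n.-tuple (cube d) -> \bar R) :
  (forall x, 0 <= g x) ->
  \int[design_law R d n]_x g x = ((2 ^+ (d * n))^-1)%:E * \sum_x g x.
Proof.
move=> g0.
have -> : \int[design_law R d n]_x g x =
    \int[design_law R d n]_x (\sum_y g y * (\1_[set y] x)%:E).
  apply: eq_integral => x _; rewrite (bigD1 x)//= big1 ?adde0.
    by rewrite indicE mem_set// mule1.
  move=> y yx; rewrite indicE memNset ?mule0//= => xy.
  by move: yx; rewrite xy eqxx.
rewrite ge0_integral_sum//; last 2 first.
- by move=> y; exact: measurable_fun_design.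
- by move=> y x _; rewrite mule_ge0// lee_fin.
rewrite ge0_sume_distrr//; apply: eq_bigr => y _.
rewrite ge0_integralZl//; last exact: measurable_fun_design.
rewrite integral_indic//; last exact: measurable_design_set.
rewrite setIT muleC; congr (_ * _).
have -> : [set y] = [set` [set y]%SET].
  by apply/seteqP; split => z /=; rewrite inE => /eqP.
by have := @design_lawE R d n [set y]%SET; rewrite cards1 mulr1.
Qed.

End DesignLawIntegral.

Section DesignMgf.
Context {R : realType} {d n : nat}.
Implicit Types (g h : cube d -> R) (A : {set 'I_n}).

Lemma expR_le_quad (x : R) : `|x| <= 1 / 2 -> expR x <= 1 + x + 2 * x ^+ 2.
Proof.
move=> x2; have xlt1 : x < 1 by rewrite (le_lt_trans (ler_norm x))// (le_lt_trans x2)//; lra.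
have : expR x * (1 - x) <= 1.
  rewrite -[leRHS](expRxMexpNx_1 x); rewrite ler_wpM2l ?expR_ge0//.
  exact: expR_ge1Dx.
have x1 : 0 < 1 - x by lra.
rewrite -ler_pdivlMr// => /le_trans; apply; rewrite ler_pdivrMr//.
have : 0 <= x ^+ 2 * (1 - 2 * x).
  rewrite mulr_ge0 ?sqr_ge0// subr_ge0.
  by have := ler_norm x; lra.
by nra.
Qed.

Lemma sqr_le_expR_sum (x : R) : x ^+ 2 <= 4 * (expR x + expR (- x)).
Proof.
wlog x0 : x / 0 <= x.
  move=> H; have [/H//|x0] := leP 0 x.
  by have := H (- x); rewrite sqrrN opprK addrC => -> //; rewrite oppr_ge0 ltW.
have e1 : 1 + x / 2 <= expR (x / 2) by exact: expR_ge1Dx.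
have -> : expR x = expR (x / 2) ^+ 2 by rewrite expr2 -expRD -splitr.
have := expR_gt0 (- x); have : 0 <= x / 2 by lra.
by nra.
Qed.

Lemma cube_mean_mgf_le g (t : R) : (forall x, `|g x| <= 2) -> cube_mean g = 0 ->
  `|t| <= 1 / 4 -> cube_mean (fun x => expR (t * g x)) <= expR (8 * t ^+ 2).
Proof.
move=> g2 g0 t4; apply: (@le_trans _ _ (1 + 8 * t ^+ 2)); last exact: expR_ge1Dx.
apply: (@le_trans _ _ (cube_mean (fun x => (1 + 8 * t ^+ 2) + t * g x))).
  apply: ler_cube_mean => x; apply: le_trans (expR_le_quad _) _.
    by rewrite normrM; have := g2 x; have := normr_ge0 t; have := normr_ge0 (g x); nra.
  have : (t * g x) ^+ 2 <= t ^+ 2 * 4.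
    rewrite exprMn ler_wpM2l ?sqr_ge0//.
    by rewrite -real_normK ?num_real//; have := g2 x; have := normr_ge0 (g x); nra.
  by lra.
by rewrite cube_meanD cube_meanZ g0 mulr0 addr0 cube_mean_cst.
Qed.

Lemma design_sum_prod (G : 'I_n -> cube d -> R) :
  (2 ^+ (d * n))^-1 * \sum_(x : n.-tuple (cube d)) \prod_j G j (tnth x j) =
  \prod_j cube_mean (G j).
Proof.
rewrite /cube_mean big_split/= prodr_const card_ord exprVn -exprM; congr (_ * _).
by rewrite tuple_sum_prod.
Qed.

Local Open Scope ereal_scope.
Context (sigma : R) (Q : probability (n.-tuple R) R).
Hypothesis (admQ : admissible_noise sigma Q).

Lemma measurable_regression_sum g h A :
  measurable_fun [set: n.-tuple (cube d) * n.-tuple R]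
    (fun w => \sum_(j in A) (g (tnth w.1 j) + h (tnth w.1 j) * tnth w.2 j))%R.
Proof.
have mtn1 j (k : cube d -> R) :
  measurable_fun [set: n.-tuple (cube d) * n.-tuple R] (fun w => k (tnth w.1 j)).
  apply: (measurableT_comp (f := fun x => k (tnth x j))) => //.
  exact: measurable_fun_design.
under eq_fun do rewrite big_mkcond/=.
apply: measurable_sum => j; case: (j \in A) => //.
apply: measurable_funD => //; apply: measurable_funM => //.
apply: (measurableT_comp (f := fun x : n.-tuple R => tnth x j)) => //.
exact: measurable_tnth.
Qed.

Lemma regression_mgf_le g h A (t : R) : (forall x, `|g x| <= 2)%R ->
  (forall x, `|h x| <= 1)%R -> cube_mean g = 0%R -> (`|t| <= 1 / 4)%R ->
  \int[design_law R d n \x Q]_w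
     (expR (t * \sum_(j in A) (g (tnth w.1 j) + h (tnth w.1 j) * tnth w.2 j)))%:E
  <= (expR ((8 + sigma ^+ 2 / 2) * t ^+ 2 * #|A|%:R))%:E.
Proof.
move=> g2 h1 g0 t4; have [indepQ _ mgfQ] := admQ.
set F := (X in \int[_]_w X w).
have mF : measurable_fun setT F.
  apply/measurable_EFinP; apply: measurableT_comp => //.
  apply: measurable_funM => //; exact: measurable_regression_sum.
have F0 w : 0 <= F w by rewrite lee_fin expR_ge0.
rewrite fubini_tonelli1// /fubini_F.
pose C : R := expR (sigma ^+ 2 / 2 * t ^+ 2 * #|A|%:R).
pose G j (x : cube d) : R := if j \in A then expR (t * g x) else 1%R.
apply: (@le_trans _ _ (\int[design_law R d n]_x
    (C * \prod_j G j (tnth x j))%:E)).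
  apply: ge0_le_integral => //.
  - by move=> x _; apply: integral_ge0 => e _.
  - exact: measurable_fun_design.
  - exact: measurable_fun_design.
  move=> x _; pose a j := if j \in A then (t * h (tnth x j))%R else 0%R.
  have mtn j : measurable_fun [set: n.-tuple R] (fun e => tnth e j).
    exact: measurable_tnth.
  have FE e : F (x, e) =
      (\prod_j G j (tnth x j))%:E * (expR (\sum_j a j * tnth e j))%:E.
    rewrite /F/= -EFinM; congr (_%:E).
    have -> : (\prod_j G j (tnth x j) = expR (\sum_(j in A) t * g (tnth x j)))%R.
      by rewrite expR_sum [RHS]big_mkcond.
    rewrite -expRD; congr expR; rewrite mulr_sumr [X in (_ + X)%R](_ : _ =
        \sum_(j in A) a j * tnth e j)%R.
      by rewrite -big_split; apply: eq_bigr => j jA; rewrite /a jA mulrDr mulrA.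
    rewrite [RHS]big_mkcond; apply: eq_bigr => j _; rewrite /a.
    by case: ifP => // _; rewrite mul0r.
  rewrite (_ : integral _ _ _ = \int[Q]_e ((\prod_j G j (tnth x j))%:E *
      (expR (\sum_j a j * tnth e j))%:E)); last by apply: eq_integral => e _; exact: FE.
  have P0 : (0 <= \prod_j G j (tnth x j))%R.
    by apply: prodr_ge0 => j _; rewrite /G; case: ifP => // _; exact: expR_ge0.
  have mexp : measurable_fun [set: n.-tuple R]
      (fun e => (expR (\sum_j a j * tnth e j))%:E).
    apply/measurable_EFinP; apply: measurableT_comp => //.
    by apply: measurable_sum => j; exact: measurable_funM.
  rewrite ge0_integralZl ?lee_fin//.
  rewrite EFinM muleC lee_wpmul2r ?lee_fin//.
  apply: le_trans (noise_mgf_le mtn indepQ a mgfQ) _.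
  rewrite lee_fin ler_expR -[leRHS]mulrA ler_wpM2l ?divr_ge0 ?sqr_ge0//.
  rewrite mulr_natr -sumr_const [leRHS]big_mkcond; apply: ler_sum => j _.
  rewrite /a; case: ifP => _; last by rewrite expr0n.
  by rewrite exprMn ler_piMr ?sqr_ge0// -real_normK ?num_real// expr_le1.
rewrite integral_design_law; last first.
  move=> x; rewrite lee_fin mulr_ge0 ?expR_ge0// prodr_ge0// => j _.
  by rewrite /G; case: ifP => // _; exact: expR_ge0.
rewrite sumEFin -EFinM lee_fin -mulr_sumr mulrCA design_sum_prod.
have -> : ((8 + sigma ^+ 2 / 2) * t ^+ 2 * #|A|%:R =
    sigma ^+ 2 / 2 * t ^+ 2 * #|A|%:R + 8 * t ^+ 2 * #|A|%:R)%R by ring.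
rewrite /C expRD ler_wpM2l ?expR_ge0//.
rewrite mulr_natr -sumr_const expR_sum [leRHS]big_mkcond; apply: ler_prod => j _.
rewrite /G; case: ifP => _; last by rewrite cube_mean_cst ler01 lexx.
by rewrite cube_mean_ge0//=; exact: cube_mean_mgf_le.
Qed.

End DesignMgf.

(** * The thresholding estimator *)

Section Influences.
Context {R : realType} {d : nat}.
Implicit Types (f g h : cube d -> R) (x y : cube d) (i : 'I_d) (b : bool).
Implicit Types (S T J : {set 'I_d}).

Lemma set_coord_id x i b : tnth x i = b -> set_coord x i b = x.
Proof.
by move=> xi; apply: eq_from_tnth => k; rewrite tnth_mktuple; case: eqP => [->|//].
Qed.

Lemma set_coord_flip x i b : tnth x i = ~~ b -> set_coord x i b = flip i x.
Proof.
move=> xi; apply: eq_from_tnth => k; rewrite !tnth_mktuple.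
by case: eqP => [->|//]; rewrite xi negbK.
Qed.

Lemma cube_diffE i f x :
  cube_diff i f x = walsh [set i]%SET x * (f x - f (flip i x)).
Proof.
rewrite /cube_diff /walsh big_set1; case xi : (tnth x i).
  by rewrite (set_coord_id xi) (set_coord_flip (b := false))//=; ring.
by rewrite (set_coord_id xi) (set_coord_flip (b := true))//=; ring.
Qed.

Lemma norm_cube_diff i f x : `|cube_diff i f x| = `|f x - f (flip i x)|.
Proof. by rewrite cube_diffE normrM norm_walsh mul1r. Qed.

Lemma fourier_sub_flip i f S :
  fourier (fun x => f x - f (flip i x)) S = (i \in S)%:R * (2 * fourier f S).
Proof.
rewrite fourierB {2}/fourier.
rewrite -(cube_mean_flip i (fun x => f (flip i x) * walsh S x)).
under [X in _ - X]eq_cube_mean do rewrite flipK.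
case: (boolP (i \in S)) => iS.
  under [X in _ - X]eq_cube_mean do rewrite walsh_flip_in// mulrN -mulN1r.
  by rewrite cube_meanZ mul1r mulN1r opprK -[cube_mean _]/(fourier f S); ring.
under [X in _ - X]eq_cube_mean do rewrite walsh_flip_notin//.
by rewrite -[cube_mean _]/(fourier f S) subrr mul0r.
Qed.

Lemma cube_mean_diff_sqr i f :
  cube_mean (fun x => cube_diff i f x ^+ 2) =
  4 * \sum_(S : {set 'I_d} | i \in S) fourier f S ^+ 2.
Proof.
transitivity (l2normsq (fun x => f x - f (flip i x))).
  by apply: eq_cube_mean => x; rewrite cube_diffE exprMn walsh_sqr mul1r.
rewrite parseval [in RHS]big_mkcond/= mulr_sumr; apply: eq_bigr => S _.
by rewrite fourier_sub_flip; case: ifP => _ /=; ring.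
Qed.

Lemma total_influence2E f :
  total_influence2 f = 4 * \sum_(S : {set 'I_d}) #|S|%:R * fourier f S ^+ 2.
Proof.
rewrite /total_influence2; under eq_bigr do rewrite cube_mean_diff_sqr big_mkcond/=.
rewrite -mulr_sumr exchange_big/=; congr (_ * _); apply: eq_bigr => S _.
by rewrite -big_mkcond/= sumr_const mulr_natl.
Qed.

Lemma fourier_tail_le f (k : nat) :
  4 * k%:R * \sum_(S : {set 'I_d} | (k < #|S|)%N) fourier f S ^+ 2 <=
  total_influence2 f.
Proof.
rewrite total_influence2E -mulrA ler_wpM2l// big_mkcond/= mulr_sumr.
apply: ler_sum => S _; case: ifP => kS; last by rewrite mulr0 mulr_ge0 ?sqr_ge0.
by rewrite ler_wpM2r ?sqr_ge0// ler_nat ltnW.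
Qed.

Lemma cube_mean_weighted_Cauchy_Schwarz (w f g : cube d -> R) :
  (forall x, 0 <= w x) ->
  cube_mean (fun x => w x * (f x * g x)) ^+ 2 <=
  cube_mean (fun x => w x * f x ^+ 2) * cube_mean (fun x => w x * g x ^+ 2).
Proof.
move=> w0; pose s x := Num.sqrt (w x).
have sw x : s x ^+ 2 = w x by rewrite sqr_sqrtr.
have := cube_mean_Cauchy_Schwarz (fun x => s x * f x) (fun x => s x * g x).
under [X in X ^+ 2 <= _]eq_cube_mean do rewrite mulrACA -expr2 sw.
under [X in _ <= X * _]eq_cube_mean do rewrite exprMn sw.
by under [X in _ <= _ * X]eq_cube_mean do rewrite exprMn sw.
Qed.

(* Duality with the (2,4) inequality: the weight W satisfies 2W = <g, h> with h
   the low-degree part and g = f - f o flip, and two weighted Cauchy-Schwarz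
   steps give <g, h>^4 <= (E|g|)^3 E[h^4] because |g| <= 1. *)
Lemma low_degree_influence_le i f k : (forall x, 0 <= f x <= 1) ->
  (\sum_(S : {set 'I_d} | (i \in S) && (#|S| <= k)%N) fourier f S ^+ 2) ^+ 2 <=
  9 ^+ k * influence i f ^+ 3.
Proof.
move=> f01; set W := \sum_(S | _) _.
have W0 : 0 <= W by apply: sumr_ge0 => S _; exact: sqr_ge0.
pose a S := if (i \in S) && (#|S| <= k)%N then fourier f S else 0.
pose g x := f x - f (flip i x).
pose h x := \sum_(S : {set 'I_d} | S \subset [set: 'I_d]%SET) a S * walsh S x.
have g1 x : `|g x| <= 1.
  by have := f01 x; have := f01 (flip i x); rewrite ler_norml /g; lra.
have I0 : 0 <= influence i f by apply: cube_mean_ge0.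
have IE : cube_mean (fun x => `|g x|) = influence i f.
  by apply: eq_cube_mean => x; rewrite norm_cube_diff.
have ghE : cube_mean (fun x => g x * h x) = 2 * W.
  under eq_cube_mean do rewrite mulr_sumr.
  rewrite cube_mean_sum /W [in RHS]big_mkcond/= mulr_sumr.
  apply: eq_big => [S|S _]; first by rewrite finset.subsetT.
  under eq_cube_mean do rewrite mulrCA.
  rewrite cube_meanZ -/(fourier g S) fourier_sub_flip /a.
  by case: (i \in S); case: (#|S| <= k)%N => /=; ring.
have h4 : cube_mean (fun x => h x ^+ 4) <= (3 ^+ k * W) ^+ 2.
  apply: le_trans (bonami _ _) _; rewrite ler_sqr ?nnegrE; last 2 first.
  - by apply: sumr_ge0 => S _; rewrite mulr_ge0 ?sqr_ge0 ?exprn_ge0.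
  - by rewrite mulr_ge0 ?exprn_ge0.
  rewrite /W [in leRHS]big_mkcond/= mulr_sumr; under eq_bigl do rewrite finset.subsetT.
  apply: ler_sum => S _; rewrite /a; case: ifP => [/andP[_ Sk]|_].
    by rewrite ler_wpM2r ?sqr_ge0// ler_weXn2l// ler1n.
  by rewrite expr0n/= !mulr0.
have step1 : (2 * W) ^+ 2 <= influence i f * cube_mean (fun x => `|g x| * h x ^+ 2).
  rewrite -ghE -IE.
  have := @cube_mean_weighted_Cauchy_Schwarz (fun x => `|g x|) (fun=> 1)
    (fun x => Num.sg (g x) * h x) (fun=> normr_ge0 _).
  under [X in X ^+ 2 <= _]eq_cube_mean do rewrite mul1r mulrA [`|_| * _]mulrC -numEsg.
  under [X in _ <= X * _]eq_cube_mean do rewrite expr1n mulr1.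
  move=> /le_trans; apply; rewrite ler_wpM2l ?cube_mean_ge0//.
  apply: ler_cube_mean => x; rewrite ler_wpM2l// exprMn.
  rewrite ler_piMl ?sqr_ge0//; case: sgrP => _; rewrite ?expr0n ?expr1n ?sqrrN ?expr1n//.
have step2 : cube_mean (fun x => `|g x| * h x ^+ 2) ^+ 2 <=
    influence i f * (3 ^+ k * W) ^+ 2.
  have := @cube_mean_weighted_Cauchy_Schwarz (fun x => `|g x|) (fun=> 1)
    (fun x => h x ^+ 2) (fun=> normr_ge0 _).
  under [X in X ^+ 2 <= _]eq_cube_mean do rewrite mul1r.
  under [X in _ <= X * _]eq_cube_mean do rewrite expr1n mulr1.
  rewrite IE => /le_trans; apply; rewrite ler_wpM2l//; apply: le_trans h4.
  apply: ler_cube_mean => x; rewrite -exprM ler_piMl// (exprM _ 2 2) sqr_ge0//.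
have : ((2 * W) ^+ 2) ^+ 2 <= influence i f ^+ 3 * (3 ^+ k * W) ^+ 2.
  apply: (@le_trans _ _ ((influence i f * cube_mean (fun x => `|g x| * h x ^+ 2)) ^+ 2)).
    rewrite ler_sqr ?nnegrE ?sqr_ge0//; rewrite mulr_ge0 ?cube_mean_ge0// => x.
    by rewrite mulr_ge0 ?sqr_ge0.
  by rewrite exprMn [_ ^+ 3]exprSr -mulrA ler_wpM2l ?sqr_ge0.
have [->|Wn0] := eqVneq W 0.
  by move=> _; rewrite expr0n/= mulr_ge0 ?exprn_ge0.
have Wp : 0 < W by rewrite lt_neqAle eq_sym Wn0.
have -> : (3 ^+ k * W) ^+ 2 = W ^+ 2 * 9 ^+ k.
  by rewrite exprMn -exprM mulnC exprM mulrC (_ : 3 ^+ 2 = 9)//; ring.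
have -> : ((2 * W) ^+ 2) ^+ 2 = W ^+ 2 * (16 * W ^+ 2) by ring.
rewrite [X in _ <= X -> _]mulrCA ler_pM2l ?exprn_gt0// [X in _ <= X -> _]mulrC; apply: le_trans.
by rewrite ler_peMl ?sqr_ge0//; lra.
Qed.

Lemma low_degree_small_influence i f k : (forall x, 0 <= f x <= 1) ->
  influence i f <= (81 ^+ k)^-1 ->
  \sum_(S : {set 'I_d} | (i \in S) && (#|S| <= k)%N) fourier f S ^+ 2 <=
  (3 ^+ k)^-1 * influence i f.
Proof.
move=> f01 Ik.
have I0 : 0 <= influence i f by apply: cube_mean_ge0.
rewrite -ler_sqr ?nnegrE; last 2 first.
- by apply: sumr_ge0 => S _; exact: sqr_ge0.
- by rewrite mulr_ge0 ?invr_ge0 ?exprn_ge0.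
apply: le_trans (low_degree_influence_le i k f01) _.
rewrite [in leRHS]exprMn exprS mulrA ler_wpM2r ?sqr_ge0//.
apply: (@le_trans _ _ (9 ^+ k * (81 ^+ k)^-1)); first by rewrite ler_wpM2l ?exprn_ge0.
rewrite -!exprVn -exprMn -exprM mulnC exprM (_ : 9 * 81^-1 = 3^-1 ^+ 2)//.
by rewrite exprVn; field.
Qed.

Definition face_mean f i b : R := cube_mean (fun x => f (set_coord x i b)).

Lemma influence_monotone f i : cube_monotone f ->
  influence i f = face_mean f i true - face_mean f i false.
Proof.
move=> fm; rewrite /face_mean -cube_meanB; apply: eq_cube_mean => x.
rewrite ger0_norm// subr_ge0; apply: fm => k; rewrite !tnth_mktuple.
by case: eqP => // _; exact: implybb.
Qed.

Lemma face_mean_indic f i b :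
  face_mean f i b = 2 * cube_mean (fun x => f x * (tnth x i == b)%:R).
Proof.
rewrite mulr2n mulrDl mul1r -[X in _ + X](cube_mean_flip i) -cube_meanD.
apply: eq_cube_mean => x; rewrite !tnth_mktuple eqxx.
have [xb|xb] := eqVneq (tnth x i) b.
  rewrite set_coord_id// mulr1 -xb; case: (tnth x i);
  by rewrite /= mulr0 addr0.
rewrite set_coord_flip; last by move: xb; case: (tnth x i); case: b.
by move: xb; case: (tnth x i); case: b => //= _; rewrite mulr0 add0r mulr1.
Qed.

Lemma cube_mean_coord i b : cube_mean (fun x => (tnth x i == b)%:R : R) = 1 / 2.
Proof.
have := face_mean_indic (fun=> 1) i b; rewrite /face_mean cube_mean_cst.
by under eq_cube_mean do rewrite mul1r; lra.
Qed.

Lemma face_mean_centered f i b :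
  cube_mean (fun x => (f x - face_mean f i b) * (tnth x i == b)%:R) = 0.
Proof.
under eq_cube_mean do rewrite mulrBl.
rewrite cube_meanB cube_meanZ cube_mean_coord face_mean_indic; lra.
Qed.

Lemma face_mean_itv f i b : (forall x, 0 <= f x <= 1) -> 0 <= face_mean f i b <= 1.
Proof.
move=> f01; rewrite cube_mean_ge0/=; last by move=> x; case/andP: (f01 (set_coord x i b)).
rewrite -[leRHS](@cube_mean_cst R d 1); apply: ler_cube_mean => x.
by case/andP: (f01 (set_coord x i b)).
Qed.

Lemma norm_fourier_le1 f S : (forall x, 0 <= f x <= 1) -> `|fourier f S| <= 1.
Proof.
move=> f01; rewrite ler_norml; apply/andP; split.
  rewrite -[leLHS](@cube_mean_cst R d); apply: ler_cube_mean => x.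
  have := norm_walsh (R := R) S x; have := ler_norm (- (walsh S x : R)); rewrite normrN.
  by have := f01 x; nra.
rewrite -[leRHS](@cube_mean_cst R d); apply: ler_cube_mean => x.
have := norm_walsh (R := R) S x; have := ler_norm (walsh S x : R).
by have := f01 x; nra.
Qed.

End Influences.

Section Sampling.
Context {R : realType} {d n : nat}.
Implicit Types (f g h : cube d -> R) (x y : cube d) (i : 'I_d) (b : bool).
Implicit Types (S T : {set 'I_d}) (A : {set 'I_n}).
Implicit Types (w : n.-tuple (cube d) * n.-tuple R).

Definition regression_sum g h A w : R :=
  \sum_(j in A) (g (tnth w.1 j) + h (tnth w.1 j) * tnth w.2 j).

Definition first_half : {set 'I_n} := [set j : 'I_n | (j < n./2)%N]%SET.
Definition second_half : {set 'I_n} := [set j : 'I_n | (n./2 <= j)%N]%SET.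

Lemma card_first_half : #|first_half| = n./2.
Proof.
have hn : (n./2 <= n)%N by rewrite leq_half_double ltnW// ltnS -addnn leq_addr.
rewrite -sum1_card; under eq_bigl do rewrite inE.
by rewrite (big_ord_narrow hn) sum_nat_const card_ord muln1.
Qed.

Lemma card_second_half : #|second_half| = (n - n./2)%N.
Proof.
have <- : (~: first_half)%SET = second_half.
  by apply/setP => j; rewrite !inE -leqNgt.
have := cardsC first_half; rewrite card_first_half card_ord.
by move=> /(congr1 (subn^~ n./2)); rewrite addKn.
Qed.

Definition indic_coord i b x : R := (tnth x i == b)%:R.

Definition face_dev f i b : n.-tuple (cube d) * n.-tuple R -> R :=
  regression_sum (fun x => (f x - face_mean f i b) * indic_coord i b x)
    (indic_coord i b) first_half.

Definition count_dev i b : n.-tuple (cube d) * n.-tuple R -> R :=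
  regression_sum (fun x => indic_coord i b x - 1 / 2) (fun=> 0) first_half.

Definition fourier_dev f S : n.-tuple (cube d) * n.-tuple R -> R :=
  regression_sum (fun x => f x * walsh S x - fourier f S) (walsh S) second_half.

Lemma fourier_coef_est_dev f S w : (n./2 < n)%N ->
  fourier_coef_est (regression_sample f w) S - fourier f S =
  (n - n./2)%:R^-1 * fourier_dev f S w.
Proof.
move=> hn; have n0 : (n - n./2)%:R != 0 :> R by rewrite pnatr_eq0 subn_eq0 -ltnNge.
apply: (mulfI n0); rewrite mulrBr !mulVKf// /fourier_dev /regression_sum.
under [RHS]eq_bigr do rewrite addrAC.
rewrite [RHS]big_split/= sumr_const card_second_half mulNrn mulr_natl; congr (_ - _).
apply: eq_big => [j|j _]; first by rewrite inE.
by rewrite /obsX /obsY tnth_mktuple /=; ring.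
Qed.

(* In Defs.v these comprehensions denote classical sets, not finite sets. *)
Lemma natr_card_comprehension (P : pred 'I_n) :
  #|[set j | P j]|%:R = \sum_j (P j)%:R :> R.
Proof.
rewrite -sum1_card natr_sum big_mkcond; apply: eq_bigr => j _.
rewrite (_ : (j \in _) = P j); first by case: (P j).
by apply/idP/idP; rewrite !inE.
Qed.

Lemma count_coord_dev f i b w :
  #|[set j : 'I_n | (j < n./2)%N && (tnth (obsX (regression_sample f w) j) i == b)]|%:R
  = n./2%:R / 2 + count_dev i b w.
Proof.
rewrite /count_dev /regression_sum.
under eq_bigr do rewrite mul0r addr0.
rewrite big_split/= sumr_const card_first_half mulNrn -[(1 / 2) *+ _]mulr_natr.
rewrite (_ : _ / 2 + _ = \sum_(j in first_half) indic_coord i b (tnth w.1 j)); last lra.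
rewrite natr_card_comprehension [RHS]big_mkcond/=; apply: eq_bigr => j _.
rewrite inE /obsX tnth_mktuple/= /indic_coord.
by case: (j < _)%N; case: (_ == b).
Qed.

Lemma cond_mean_dev f i b w (N := n./2%:R / 2 + count_dev i b w) : N != 0 ->
  cond_mean (regression_sample f w) i b - face_mean f i b = face_dev f i b w / N.
Proof.
move=> N0; apply: (mulIf N0); rewrite mulrBl divfK//.
rewrite /cond_mean count_coord_dev -/N divfK//.
rewrite /N -(count_coord_dev f) natr_card_comprehension mulr_sumr /face_dev.
rewrite /regression_sum big_mkcond/= -sumrB [RHS]big_mkcond/=.
apply: eq_bigr => j _; rewrite !inE /obsX /obsY tnth_mktuple/= /indic_coord.
by case: (j < _)%N; case: (_ == b) => /=; ring.
Qed.

Lemma influence_est_close f i w (s : R) : cube_monotone f ->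
  (0 < n./2)%N -> 0 < s <= 1 / 4 ->
  (forall b, `|face_dev f i b w| < s * n./2%:R) ->
  (forall b, `|count_dev i b w| < s * n./2%:R) ->
  `|influence_est (regression_sample f w) i - influence i f| < 8 * s.
Proof.
move=> fm n0 /andP[s0 s4] Us Vs.
have m0 : 0 < n./2%:R :> R by rewrite ltr0n.
have close b : `|cond_mean (regression_sample f w) i b - face_mean f i b| < 4 * s.
  have := Vs b; rewrite ltr_norml => /andP[Vl _].
  have N0 : n./2%:R / 4 < n./2%:R / 2 + count_dev i b w.
    have : s * n./2%:R <= 1 / 4 * n./2%:R by rewrite ler_pM2r.
    by lra.
  have Np : 0 < n./2%:R / 2 + count_dev i b w by apply: lt_trans N0; lra.
  rewrite cond_mean_dev ?gt_eqF// normrM normfV (gtr0_norm Np) ltr_pdivrMr//.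
  apply: lt_trans (Us b) _.
  rewrite -mulrA mulrCA ltr_pM2l//; lra.
rewrite influence_monotone// /influence_est.
have := close true; have := close false; rewrite !ltr_norml; lra.
Qed.

End Sampling.

Section PointwiseLoss.
Context {R : realType} {d n : nat}.
Variables (gamma c0 : R) (f : cube d -> R).
Hypotheses (f01 : forall x, 0 <= f x <= 1) (fm : cube_monotone f).
Hypothesis (n_gt1 : (1 < n)%N).
Local Notation k := (@degree_cutoff R n gamma c0).
Local Notation delta := (@influence_cutoff R n gamma c0).
Hypothesis (deltaE : delta = (81 ^+ k)^-1).
Implicit Types (w : n.-tuple (cube d) * n.-tuple R) (S : {set 'I_d}).

Definition relevant_coords (dlt : R) (h : cube d -> R) : {set 'I_d} :=
  [set i | dlt <= influence i h]%SET.

Definition threshold : R := delta / 32 * n./2%:R.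

Definition candidate : pred {set 'I_d} :=
  fun S => (S \subset relevant_coords (delta / 4) f) && (#|S| <= k)%N.

Definition bias_bound : R :=
  total_influence2 f / (4 * k%:R) + (3 ^+ k)^-1 * total_influence f.

Lemma clip_sqr_le (g c : R) : 0 <= c <= 1 ->
  (Num.max 0 (Num.min g 1) - c) ^+ 2 <= (g - c) ^+ 2.
Proof.
move=> /andP[c0' c1]; rewrite /Num.max /Num.min.
case: (ltP g 1) => g1; case: ltP => g0 //; nra.
Qed.

Lemma estimator_itv (D : sample R d n) x : 0 <= fourier_estimator gamma c0 D x <= 1.
Proof.
rewrite /fourier_estimator; set g := \sum_(S | _) _.
by rewrite /Num.max /Num.min; case: (ltP g 1) => g1; case: ltP => g0; lra.
Qed.

Let d0_gt0 : (0 < k)%N.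
Proof. by rewrite /degree_cutoff leq_max orbT. Qed.

Lemma influence_ge0 i (h : cube d -> R) : 0 <= influence i h.
Proof. exact: cube_mean_ge0. Qed.

Lemma total_influence2_ge0 (h : cube d -> R) : 0 <= total_influence2 h.
Proof. by apply: sumr_ge0 => i _; apply: cube_mean_ge0 => x; exact: sqr_ge0. Qed.

Lemma bias_bound_ge0 : 0 <= bias_bound.
Proof.
rewrite addr_ge0// ?divr_ge0 ?mulr_ge0 ?total_influence2_ge0 ?invr_ge0 ?exprn_ge0//.
by apply: sumr_ge0 => i _; exact: influence_ge0.
Qed.

(* If some deviation exceeds the threshold, the loss is at most 1 by clipping;
   otherwise selected frequencies are candidates and unselected coordinates have
   influence at most delta. *)
Lemma loss_le w :
  l2normsq (fun x => fourier_estimator gamma c0 (regression_sample f w) x - f x) <=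
  bias_bound +
  \sum_i \sum_(b : bool) ((threshold <= `|face_dev f i b w|)%R%:R +
                          (threshold <= `|count_dev i b w|)%R%:R) +
  \sum_(S | candidate S) ((n - n./2)%:R^-1 * fourier_dev f S w) ^+ 2.
Proof.
set D := regression_sample f w.
set bad := \sum_i _; set var := \sum_(S | _) _.
have var0 : 0 <= var by apply: sumr_ge0 => S _; exact: sqr_ge0.
have bad0 : 0 <= bad.
  by apply: sumr_ge0 => i _; apply: sumr_ge0 => b _; rewrite addr_ge0 ?ler0n.
have bias0 := bias_bound_ge0.
have [/existsP[i /existsP[b ib]]|good] := boolP [exists i, exists b,
    (threshold <= `|face_dev f i b w|) || (threshold <= `|count_dev i b w|)].
  apply: (@le_trans _ _ 1).
    rewrite -[leRHS](@cube_mean_cst R d 1); apply: ler_cube_mean => x.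
    by have := f01 x; have := estimator_itv D x; nra.
  pose t j b' : R := (threshold <= `|face_dev f j b' w|)%R%:R +
                     (threshold <= `|count_dev j b' w|)%R%:R.
  have t0 j b' : 0 <= t j b' by rewrite addr_ge0 ?ler0n.
  have t1 : 1 <= t i b.
    by rewrite /t; case/orP : ib => ->; rewrite ?lerDl ?lerDr ler0n.
  have t2 : t i b <= \sum_b' t i b'.
    by rewrite (bigD1 b)//= lerDl; apply: sumr_ge0 => b' _.
  have t3 : \sum_b' t i b' <= bad.
    rewrite /bad [leRHS](bigD1 i)//= lerDl; apply: sumr_ge0 => j _.
    by apply: sumr_ge0 => b' _; exact: t0.
  by rewrite (le_trans t1)// (le_trans t2)// (le_trans t3)// addrAC lerDr addr_ge0.
have m0 : (0 < n./2)%N by rewrite half_gt0.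
have k81 : 1 <= 81 ^+ k :> R by rewrite exprn_ege1// ler1n.
have dl : 0 < delta <= 1.
  by rewrite deltaE invr_gt0 exprn_gt0//= invf_le1// exprn_gt0.
have lowI i := low_degree_small_influence (i := i) (k := k) f01.
rewrite -deltaE in lowI; clear deltaE k81.
have close i : `|influence_est D i - influence i f| < delta / 4.
  rewrite (_ : delta / 4 = 8 * (delta / 32)); last lra.
  move: good => /existsPn/(_ i)/existsPn good.
  apply: influence_est_close => //; first lra.
  - by move=> b; have := good b; rewrite negb_or -!ltNge => /andP[].
  - by move=> b; have := good b; rewrite negb_or -!ltNge => /andP[].
pose sel S := (S \subset selected_coords gamma c0 D) && (#|S| <= k)%N.
pose a S := if sel S then fourier_coef_est D S else 0.
apply: (@le_trans _ _ (l2normsq (fun x => \sum_S a S * walsh S x - f x))).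
  apply: ler_cube_mean => x; rewrite [X in (_ <= (X - _) ^+ 2)](_ : _ =
    \sum_(S | sel S) (fourier_coef_est D S * walsh S x)); first exact: clip_sqr_le.
  rewrite [RHS]big_mkcond; apply: eq_bigr => S _; rewrite /a.
  by case: ifP => _; rewrite ?mul0r.
rewrite l2normsq_walsh_sum.
pose small i := influence i f <= delta.
pose low i S := (i \in S) && (#|S| <= k)%N.
have term S : (a S - fourier f S) ^+ 2 <=
    (if candidate S then ((n - n./2)%:R^-1 * fourier_dev f S w) ^+ 2 else 0) +
    (if (k < #|S|)%N then fourier f S ^+ 2 else 0) +
    \sum_(i | small i) (if low i S then fourier f S ^+ 2 else 0).
  have cand0 : 0 <= (if candidate S then ((n - n./2)%:R^-1 * fourier_dev f S w) ^+ 2 else 0).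
    by case: ifP => _ //; exact: sqr_ge0.
  have tail0 : 0 <= (if (k < #|S|)%N then fourier f S ^+ 2 else 0).
    by case: ifP => _ //; exact: sqr_ge0.
  have low0 i : 0 <= (if low i S then fourier f S ^+ 2 else 0).
    by case: ifP => _ //; exact: sqr_ge0.
  have sum0 : 0 <= \sum_(i | small i) (if low i S then fourier f S ^+ 2 else 0).
    by apply: sumr_ge0 => i _.
  rewrite /a; case: ifP => [selS|].
    have -> : candidate S.
      move: selS => /andP[/fintype.subsetP SJ Sk]; rewrite /candidate Sk andbT.
      apply/fintype.subsetP => i /SJ; rewrite !inE => iD.
      by have := close i; rewrite ltr_norml; lra.
    rewrite fourier_coef_est_dev//; first lra.
    by rewrite ltn_half_double -addnn -{1}[n]addn0 ltn_add2l ltnW.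
  move=> /negbT; rewrite sub0r sqrrN negb_and -ltnNge orbC.
  case: ltnP => [kS _|Sk]; first by rewrite -addrA; apply: ler_wpDl; lra.
  move=> /= /subsetPn[i iS iD]; apply: ler_wpDl; first by rewrite addr0.
  have smi : small i.
    move: iD; rewrite inE -ltNge => iD; rewrite /small.
    by have := close i; rewrite ltr_norml; lra.
  have lowi : low i S by rewrite /low iS Sk.
  by rewrite (bigD1 i)//= lowi lerDl; apply: sumr_ge0 => j _; exact: low0.
apply: le_trans (ler_sum _ (fun S _ => term S)) _.
rewrite big_split/= big_split/= -!big_mkcond/= exchange_big/= -/var.
set tail := \sum_(S | (k < _)%N) _.
have tailB : tail <= total_influence2 f / (4 * k%:R).
  by rewrite ler_pdivlMr ?mulr_gt0 ?ltr0n// mulrC fourier_tail_le.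
have lowB : \sum_(i | small i) \sum_S (if low i S then fourier f S ^+ 2 else 0) <=
    (3 ^+ k)^-1 * total_influence f.
  rewrite /total_influence mulr_sumr big_mkcond/=; apply: ler_sum => i _.
  case: ifP => si; last by rewrite mulr_ge0 ?invr_ge0 ?exprn_ge0 ?influence_ge0.
  rewrite -big_mkcond/=; exact: lowI.
rewrite -addrA [leRHS]addrC lerD2l; apply: ler_wpDr => //; exact: lerD.
Qed.

(* Each candidate S has weight delta^(|S| - k) >= 1, and these weights sum to
   delta^-k (1 + delta)^#|J| over the subsets of J. *)
Lemma card_candidate_le (K : R) : total_influence f <= K ->
  #|candidate|%:R <= delta ^- k * expR (4 * K).
Proof.
move=> IK.
have k81 : 1 <= 81 ^+ k :> R by rewrite exprn_ege1// ler1n.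
have /andP[d_gt0 d_le1] : 0 < delta <= 1.
  by rewrite deltaE invr_gt0 exprn_gt0//= invf_le1// exprn_gt0.
clear deltaE k81.
set J := relevant_coords (delta / 4) f.
apply: (@le_trans _ _ (\sum_(S : {set 'I_d} | S \subset J) delta ^- k * \prod_(i in S) delta)).
  rewrite -sum1_card natr_sum big_mkcond [leRHS]big_mkcond/=; apply: ler_sum => S _.
  rewrite unfold_in /candidate -/J; case: (S \subset J) => //=.
  rewrite prodr_const; case: leqP => Sk.
    rewrite mulrC ler_pdivlMr ?exprn_gt0// mul1r; apply: ler_wiXn2l => //; exact: ltW.
  by rewrite mulr_ge0 ?invr_ge0 ?exprn_ge0// ltW.
rewrite -mulr_sumr sum_subsets_prod prodr_const ler_wpM2l ?invr_ge0 ?exprn_ge0 ?(ltW d_gt0)//.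
apply: (@le_trans _ _ (expR delta ^+ #|J|)).
  by rewrite lerXn2r ?nnegrE ?expR_ge0 ?expR_ge1Dx// addr_ge0// ltW.
rewrite -expRM_natl ler_expR.
have : \sum_(i in J) delta / 4 <= K.
  apply: le_trans IK; rewrite big_mkcond/=; apply: ler_sum => i _.
  by case: ifP => [|_]; [rewrite inE|exact: influence_ge0].
by rewrite sumr_const -[_ *+ #|J|]mulr_natl; move: (#|J|%:R) => N NK; lra.
Qed.

End PointwiseLoss.

Section MeanLe.
Context {dT} {T : measurableType dT} {R : realType} (P : probability T R).
Implicit Types (phi psi : T -> R) (b c : R).

Definition mean_le phi b : Prop :=
  [/\ measurable_fun setT phi, forall x, 0 <= phi x
    & (\int[P]_x (phi x)%:E <= b%:E)%E].

Lemma mean_le_cst c : 0 <= c -> mean_le (fun=> c) c.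
Proof.
move=> c0; split => //.
by rewrite integral_cst//= [X in (_ * X)%E]probability_setT mule1.
Qed.

Lemma mean_leD phi psi b c : mean_le phi b -> mean_le psi c ->
  mean_le (fun x => phi x + psi x) (b + c).
Proof.
move=> [mphi phi0 phib] [mpsi psi0 psic]; split.
- exact: measurable_funD.
- by move=> x; rewrite addr_ge0.
under eq_integral do rewrite EFinD.
rewrite ge0_integralD//; last 4 first.
- by move=> x _; rewrite lee_fin.
- exact/measurable_EFinP.
- by move=> x _; rewrite lee_fin.
- exact/measurable_EFinP.
by rewrite EFinD; exact: leeD.
Qed.

Lemma mean_leZ phi b c : 0 <= c -> mean_le phi b ->
  mean_le (fun x => c * phi x) (c * b).
Proof.
move=> c0 [mphi phi0 phib]; split.
- exact: measurable_funM.
- by move=> x; rewrite mulr_ge0.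
under eq_integral do rewrite EFinM.
rewrite ge0_integralZl//; last 2 first.
- exact/measurable_EFinP.
- by move=> x _; rewrite lee_fin.
by rewrite EFinM lee_wpmul2l.
Qed.

Lemma mean_le_sum I (r : seq I) (Pr : pred I) (phi : I -> T -> R) (b : I -> R) :
  (forall i, Pr i -> mean_le (phi i) (b i)) ->
  mean_le (fun x => \sum_(i <- r | Pr i) phi i x) (\sum_(i <- r | Pr i) b i).
Proof.
move=> H; elim: r => [|i r IH].
  rewrite big_nil; under eq_fun do rewrite big_nil.
  exact: mean_le_cst.
rewrite big_cons; under eq_fun do rewrite big_cons.
by case: (boolP (Pr i)) => // Pi; apply: mean_leD => //; exact: H.
Qed.

Lemma le_mean_le (phi psi : T -> R) b : (forall x, 0 <= phi x) ->
  (forall x, phi x <= psi x) -> mean_le psi b -> (\int[P]_x (phi x)%:E <= b%:E)%E.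
Proof.
move=> phi0 le [_ _]; apply: le_trans; apply: le_integral_nonmeasurable => x;
by rewrite lee_fin.
Qed.

End MeanLe.

Section Concentration.
Context {R : realType} {d n : nat}.
Variables (sigma : R) (Q : probability (n.-tuple R) R).
Hypothesis (admQ : admissible_noise sigma Q).
Implicit Types (g h : cube d -> R) (A : {set 'I_n}).
Local Notation law := (design_law R d n \x Q)%E.
Local Notation v := (8 + sigma ^+ 2 / 2).

Let v8 : 8 <= v.
Proof. by rewrite lerDl divr_ge0 ?sqr_ge0. Qed.

Lemma regression_exp_mean_le g h A (t : R) : (forall x, `|g x| <= 2) ->
  (forall x, `|h x| <= 1) -> cube_mean g = 0 -> `|t| <= 1 / 4 ->
  mean_le law (fun w => expR (t * regression_sum g h A w)) (expR (v * t ^+ 2 * #|A|%:R)).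
Proof.
move=> g2 h1 g0 t4; split.
- apply: measurableT_comp => //; apply: measurable_funM => //.
  exact: measurable_regression_sum.
- by move=> w; exact: expR_ge0.
- exact: regression_mgf_le.
Qed.

Lemma regression_cosh_mean_le g h A (t : R) : (forall x, `|g x| <= 2) ->
  (forall x, `|h x| <= 1) -> cube_mean g = 0 -> `|t| <= 1 / 4 ->
  mean_le law (fun w => expR (t * regression_sum g h A w) +
                        expR (- (t * regression_sum g h A w)))
    (2 * expR (v * t ^+ 2 * #|A|%:R)).
Proof.
move=> g2 h1 g0 t4.
have := mean_leD (@regression_exp_mean_le g h A t g2 h1 g0 t4)
  (@regression_exp_mean_le g h A (- t) g2 h1 g0 _).
rewrite normrN sqrrN => /(_ t4); congr mean_le; last by rewrite mulr_natl mulr2n.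
by apply/funext => w; rewrite mulNr.
Qed.

Lemma regression_tail g h A (s : R) : (forall x, `|g x| <= 2) ->
  (forall x, `|h x| <= 1) -> cube_mean g = 0 -> 0 <= s <= 1 ->
  exists2 psi, (forall w, (s * #|A|%:R <= `|regression_sum g h A w|)%R%:R <= psi w) &
    mean_le law psi (2 * expR (- (s ^+ 2 * #|A|%:R / (4 * v)))).
Proof.
move=> g2 h1 g0 /andP[s0 s1]; pose t := s / (2 * v).
have v0 : 0 < v by apply: lt_le_trans v8.
have t0 : 0 <= t by rewrite divr_ge0// mulr_ge0// ltW.
have t4 : `|t| <= 1 / 4 by rewrite ger0_norm// ler_pdivrMr ?mulr_gt0//; have := v8; lra.
pose X := regression_sum g h A.
exists (fun w => expR (- (t * (s * #|A|%:R))) * (expR (t * X w) + expR (- (t * X w)))).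
  move=> w; have [sX|_] := leP (s * #|A|%:R) `|regression_sum g h A w|; last first.
    by rewrite mulr_ge0 ?addr_ge0 ?expR_ge0.
  have tX : expR (t * (s * #|A|%:R)) <= expR (t * X w) + expR (- (t * X w)).
    have [X0|X0] := leP 0 (X w).
      apply: (@le_trans _ _ (expR (t * X w))); last by rewrite lerDl expR_ge0.
      by rewrite ler_expR ler_wpM2l//; move: sX; rewrite ger0_norm.
    rewrite addrC; apply: (@le_trans _ _ (expR (- (t * X w)))); last first.
      by rewrite lerDl expR_ge0.
    by rewrite -mulrN ler_expR ler_wpM2l//; move: sX; rewrite ltr0_norm.
  by rewrite expRN mulrC ler_pdivlMr ?expR_gt0// mul1r.
have := mean_leZ (expR_ge0 (- (t * (s * #|A|%:R))))
  (@regression_cosh_mean_le g h A t g2 h1 g0 t4).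
congr mean_le; rewrite mulrCA -expRD; congr (_ * expR _).
by rewrite /t; field; lra.
Qed.

Lemma regression_second_moment g h A : (1 < #|A|)%N -> (forall x, `|g x| <= 2) ->
  (forall x, `|h x| <= 1) -> cube_mean g = 0 ->
  exists2 psi, (forall w, regression_sum g h A w ^+ 2 <= psi w) &
    mean_le law psi (8 * expR 1 * v * #|A|%:R).
Proof.
move=> A1 g2 h1 g0; have v0 : 0 < v by apply: lt_le_trans v8.
have N2 : 2 <= #|A|%:R :> R by rewrite ler_nat.
have vN : 16 <= v * #|A|%:R by have := v8; nra.
pose t := (Num.sqrt (v * #|A|%:R))^-1.
have t0 : 0 < t by rewrite invr_gt0 sqrtr_gt0; lra.
have t2 : t ^+ 2 = (v * #|A|%:R)^-1 by rewrite exprVn sqr_sqrtr//; lra.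
have t4 : `|t| <= 1 / 4.
  rewrite (gtr0_norm t0) -ler_sqr ?nnegrE ?(ltW t0)//.
  by rewrite t2 -[X in _ <= X]invrK lef_pV2 ?posrE; lra.
exists (fun w => 4 / t ^+ 2 * (expR (t * regression_sum g h A w) +
                               expR (- (t * regression_sum g h A w)))).
  move=> w; have := sqr_le_expR_sum (t * regression_sum g h A w).
  by rewrite exprMn [4 / _ * _]mulrAC ler_pdivlMr ?exprn_gt0// mulrC.
have c0 : 0 <= 4 / t ^+ 2 by rewrite divr_ge0// sqr_ge0.
have := mean_leZ c0 (@regression_cosh_mean_le g h A t g2 h1 g0 t4).
congr mean_le; rewrite [v * _ * _]mulrAC t2 invrK mulfV; first by ring.
by rewrite gt_eqF//; lra.
Qed.

End Concentration.

Section RiskBound.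
Context {R : realType} {d n : nat}.
Variables (gamma c0 : R) (f : cube d -> R).
Hypotheses (f01 : forall x, 0 <= f x <= 1) (fm : cube_monotone f).
Hypothesis (n_gt2 : (2 < n)%N).
Local Notation k := (@degree_cutoff R n gamma c0).
Local Notation delta := (@influence_cutoff R n gamma c0).
Hypothesis (deltaE : delta = (81 ^+ k)^-1).
Variables (sigma : R) (Q : probability (n.-tuple R) R).
Hypothesis (admQ : admissible_noise sigma Q).
Local Notation v := (8 + sigma ^+ 2 / 2).

Lemma fourier_estimator_risk_le (K : R) : total_influence f <= K ->
  (risk Q (fourier_estimator gamma c0) f <=
   (bias_bound (n := n) gamma c0 f
    + 8 * d%:R * expR (- ((delta / 32) ^+ 2 * n./2%:R / (4 * v)))
    + delta ^- k * expR (4 * K) * (8 * expR 1 * v / (n - n./2)%:R))%:E)%E.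
Proof.
move=> IK; rewrite /risk unlock.
have n_gt1 : (1 < n)%N by exact: ltn_trans n_gt2.
have k81 : 1 <= 81 ^+ k :> R by rewrite exprn_ege1// ler1n.
have dl : 0 < delta <= 1.
  by rewrite deltaE invr_gt0 exprn_gt0//= invf_le1// exprn_gt0.
clear k81.
have s01 : 0 <= delta / 32 <= 1.
  have aux (e : R) : 0 < e <= 1 -> 0 <= e / 32 <= 1 by lra.
  exact: aux.
set E := expR (- _).
have indic01 i b (x : cube d) : 0 <= (indic_coord i b x : R) <= 1.
  by rewrite /indic_coord; case: (_ == b); rewrite ?ler01 ?lexx.
have faceT i b : exists2 psi, (forall w, (threshold (n := n) gamma c0 <=
      `|face_dev f i b w|)%R%:R <= psi w) &
    mean_le (design_law R d n \x Q)%E psi (2 * E).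
  have := @regression_tail R d n sigma Q admQ
    (fun x => (f x - face_mean f i b) * indic_coord i b x) (indic_coord i b)
    (first_half (n := n)) (delta / 32) _ _ _ s01.
  rewrite card_first_half; apply.
  - move=> x; have := face_mean_itv i b f01; have := f01 x; have := indic01 i b x.
    by rewrite ler_norml; nra.
  - by move=> x; have := indic01 i b x; rewrite ler_norml; lra.
  - exact: face_mean_centered.
have countT i b : exists2 psi, (forall w, (threshold (n := n) gamma c0 <=
      `|count_dev i b w|)%R%:R <= psi w) &
    mean_le (design_law R d n \x Q)%E psi (2 * E).
  have := @regression_tail R d n sigma Q admQ
    (fun x => indic_coord i b x - 1 / 2) (fun=> 0)
    (first_half (n := n)) (delta / 32) _ _ _ s01.
  rewrite card_first_half; apply.
  - by move=> x; have := indic01 i b x; rewrite ler_norml; lra.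
  - by move=> x; rewrite normr0.
  - by rewrite cube_meanB cube_mean_cst cube_mean_coord subrr.
have devT S : exists2 psi, (forall w, fourier_dev f S w ^+ 2 <= psi w) &
    mean_le (design_law R d n \x Q)%E psi (8 * expR 1 * v * (n - n./2)%:R).
  have := @regression_second_moment R d n sigma Q admQ
    (fun x => f x * walsh S x - fourier f S) (walsh S) (second_half (n := n)).
  rewrite card_second_half; apply.
  - by lia.
  - move=> x; apply: le_trans (ler_normB _ _) _.
    rewrite normrM norm_walsh mulr1; have := norm_fourier_le1 S f01.
    by have := f01 x => /andP[f0 f1] F1; rewrite ger0_norm//; lra.
  - by move=> x; rewrite norm_walsh.
  - by rewrite cube_meanB cube_mean_cst subrr.
pose psiF i b := projT1 (cid2 (faceT i b)).
pose psiC i b := projT1 (cid2 (countT i b)).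
pose psiD S := projT1 (cid2 (devT S)).
pose Phi w := bias_bound (n := n) gamma c0 f +
  \sum_i \sum_(b : bool) (psiF i b w + psiC i b w) +
  \sum_(S | candidate (n := n) gamma c0 f S) ((n - n./2)%:R^-1 ^+ 2 * psiD S w).
have n2_gt0 : 0 < (n - n./2)%:R :> R.
  by rewrite ltr0n subn_gt0 ltn_half_double -addnn -{1}[n]addn0 ltn_add2l ltnW.
apply: (le_mean_le (psi := Phi)).
- by move=> w; apply: cube_mean_ge0 => x; exact: sqr_ge0.
- move=> w; apply: le_trans (loss_le f01 fm n_gt1 deltaE w) _.
  rewrite /Phi; apply: lerD; first apply: lerD => //.
    apply: ler_sum => i _; apply: ler_sum => b _; apply: lerD.
      by rewrite /psiF; case: cid2 => /= psi + _; apply.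
    by rewrite /psiC; case: cid2 => /= psi + _; apply.
  apply: ler_sum => S _; rewrite exprMn ler_wpM2l ?sqr_ge0//.
  by rewrite /psiD; case: cid2 => /= psi + _; apply.
have M1 : mean_le (design_law R d n \x Q)%E Phi (bias_bound (n := n) gamma c0 f +
  \sum_(i < d) \sum_(b : bool) (2 * E + 2 * E) +
  \sum_(S | candidate (n := n) gamma c0 f S)
    ((n - n./2)%:R^-1 ^+ 2 * (8 * expR 1 * v * (n - n./2)%:R))).
  apply: mean_leD; first apply: mean_leD.
  - by apply: mean_le_cst; exact: bias_bound_ge0.
  - apply: mean_le_sum => i _; apply: mean_le_sum => b _; apply: mean_leD.
      by rewrite /psiF; case: cid2.
    by rewrite /psiC; case: cid2.
  apply: mean_le_sum => S _; apply: mean_leZ; first exact: sqr_ge0.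
  by rewrite /psiD; case: cid2.
case: M1 => mPhi Phi0 leb; split => //; apply: le_trans leb _.
rewrite lee_fin; apply: lerD; first apply: lerD => //.
  rewrite !sumr_const card_bool card_ord -[leLHS]mulr_natr.
  by rewrite le_eqVlt; apply/predU1l; ring.
rewrite sumr_const.
have := card_candidate_le deltaE IK.
have -> : (n - n./2)%:R^-1 ^+ 2 * (8 * expR 1 * v * (n - n./2)%:R) =
    8 * expR 1 * v / (n - n./2)%:R by field; rewrite gt_eqF.
move=> cl; rewrite -[_ *+ _]mulr_natl ler_wpM2r//.
rewrite divr_ge0 ?ler0n// !mulr_ge0 ?expR_ge0//.
by rewrite addr_ge0// divr_ge0 ?sqr_ge0.
Qed.

Lemma fourier_estimator_risk_le1 : (risk Q (fourier_estimator gamma c0) f <= 1)%E.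
Proof.
rewrite /risk unlock.
apply: (@le_mean_le _ _ _ _ _ (fun=> 1)); last exact: mean_le_cst.
  by move=> w; apply: cube_mean_ge0 => x; exact: sqr_ge0.
move=> w; rewrite -[leRHS](@cube_mean_cst R d 1); apply: ler_cube_mean => x.
have := f01 x; have := estimator_itv gamma c0 (regression_sample f w) x.
by nra.
Qed.

End RiskBound.

(** * Choice of the constants *)

Section Asymptotics.
Context {R : realType}.

(* The cutoff is then delta = 81^-d0, so that 9^d0 delta = 9^-d0 absorbs the
   hypercontractive factor 9^d0. *)
Definition gamma_choice : R := 4 * ln 3.
Definition c0_choice : R := 5 + 2 * Num.sqrt gamma_choice.

Lemma ln3_gt0 : 0 < ln 3 :> R.
Proof. by rewrite ln_gt0// ltr1n. Qed.

Lemma gamma_choice_gt0 : 0 < gamma_choice.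
Proof. by rewrite mulr_gt0// ln3_gt0. Qed.

Lemma gamma_choice_gt : 2 * ln 3 < gamma_choice.
Proof. by rewrite ltr_pM2r ?ln3_gt0// ltr_nat. Qed.

Lemma c0_choice_gt0 : 0 < c0_choice.
Proof. by rewrite ltr_wpDr// mulr_ge0// sqrtr_ge0. Qed.

Lemma influence_cutoff_gamma_choice n :
  @influence_cutoff R n gamma_choice c0_choice =
  (81 ^+ @degree_cutoff R n gamma_choice c0_choice)^-1.
Proof.
rewrite /influence_cutoff expRN; congr (_^-1).
rewrite mulrC expRM_natl; congr (_ ^+ _).
rewrite /gamma_choice expRM_natl lnK ?posrE//; ring.
Qed.

Lemma degree_cutoff_bounds n (s := Num.sqrt (ln n%:R : R))
    (k := (@degree_cutoff R n gamma_choice c0_choice)%:R : R) :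
  2 * c0_choice <= s ->
  [/\ s <= Num.sqrt (2 * gamma_choice) * k,
      gamma_choice * k ^+ 2 <= s ^+ 2 - 5 * s + gamma_choice &
      gamma_choice * k <= Num.sqrt gamma_choice * s + gamma_choice].
Proof.
move=> cs; have g0 := gamma_choice_gt0; have c0 := c0_choice_gt0.
have sp : 0 < s by apply: lt_le_trans cs; rewrite mulr_gt0.
have s2 : s ^+ 2 = ln n%:R.
  by rewrite sqr_sqrtr// ltW// -sqrtr_gt0.
pose A := s ^+ 2 - c0_choice * s.
have A0 : s ^+ 2 / 2 <= A by rewrite /A; nra.
have A1 : 0 <= A by apply: le_trans A0; rewrite divr_ge0// sqr_ge0.
pose a := Num.sqrt (A / gamma_choice).
have a0 : 0 <= a by exact: sqrtr_ge0.
have a2 : gamma_choice * a ^+ 2 = A.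
  by rewrite sqr_sqrtr ?divr_ge0 ?(ltW g0)// mulrC divfK// gt_eqF.
have kE : k = Num.max (Num.ceil a)%:~R 1.
  rewrite /k /degree_cutoff -/s -s2 -/A (max_l A1) -/a.
  have c_ge0 : 0 <= Num.ceil a by rewrite -(ceil0 R) ceil_le.
  rewrite natr_max natr_absz (ger0_norm c_ge0)//.
have ak : a <= k by rewrite kE le_max ceil_ge.
have ka : k <= a + 1.
  rewrite kE ge_max lerDr a0 andbT.
  by have := gt_pred_ceil a; rewrite intrB; lra.
pose q := Num.sqrt gamma_choice.
have q0 : 0 < q by rewrite sqrtr_gt0.
have q2 : q ^+ 2 = gamma_choice by rewrite sqr_sqrtr// ltW.
have qa : q * a <= s.
  rewrite -ler_sqr ?nnegrE ?mulr_ge0 ?(ltW q0) ?(ltW sp)//.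
  rewrite exprMn q2 a2 /A lerBlDr lerDl mulr_ge0// ltW//.
have ga : gamma_choice * a <= q * s by rewrite -q2 expr2 -mulrA ler_pM2l.
split.
- apply: (@le_trans _ _ (Num.sqrt (2 * gamma_choice) * a)); last first.
    by rewrite ler_wpM2l ?sqrtr_ge0.
  rewrite -ler_sqr ?nnegrE ?mulr_ge0 ?sqrtr_ge0 ?(ltW sp)//.
  have -> : (Num.sqrt (2 * gamma_choice) * a) ^+ 2 = 2 * (gamma_choice * a ^+ 2).
    have q2' : Num.sqrt (2 * gamma_choice) ^+ 2 = 2 * gamma_choice.
      by rewrite sqr_sqrtr// mulr_ge0// ltW.
    by rewrite exprMn q2' -[LHS]mulrA.
  by rewrite a2; lra.
- have k0 : 0 <= k by exact: le_trans ak.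
  have : k ^+ 2 <= (a + 1) ^+ 2 by rewrite ler_sqr ?nnegrE ?addr_ge0.
  rewrite -(ler_pM2l g0) => /le_trans; apply.
  by rewrite sqrrD1 !mulrDr a2 /A /c0_choice -/q; lra.
- have : gamma_choice * k <= gamma_choice * (a + 1) by rewrite ler_pM2l.
  by rewrite mulrDr mulr1 -/q => /le_trans; apply; rewrite lerD2r.
Qed.

Lemma leq_half_mul4 n : (1 < n)%N -> (n <= n./2 * 4)%N.
Proof. by move=> n1; lia. Qed.

Lemma leq_sub_half_mul2 n : (n <= (n - n./2) * 2)%N.
Proof. by lia. Qed.

Lemma sqr_le_exp3 k : k%:R ^+ 2 <= 3 ^+ k :> R.
Proof.
rewrite -!natrX ler_nat; elim: k => // -[//|[//|k]] IH.
rewrite expnS; apply: leq_trans (leq_mul (leqnn 3) IH).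
by rewrite -!mulnn; lia.
Qed.

Lemma expRN_le_inv (x : R) : 0 < x -> expR (- x) <= x^-1.
Proof.
move=> x0; rewrite expRN lef_pV2 ?posrE ?expR_gt0//.
by apply: le_trans (expR_ge1Dx x); rewrite lerDr.
Qed.

Section Upper.
Variables (sigma eps : R).
Hypothesis eps01 : 0 < eps < 1.
Local Notation v := (8 + sigma ^+ 2 / 2).

Definition noise_rate : R := expR (- (2 * gamma_choice)) / (32 ^+ 2 * 4 * 4 * v).

(* For sqrt (ln n) below this value the trivial bound 1 on the risk suffices. *)
Definition large_cutoff : R :=
  2 * c0_choice + (2 * Num.sqrt gamma_choice + `|ln (2 / noise_rate)|) / eps.

Definition upper_const : R :=
  large_cutoff + Num.sqrt (2 * gamma_choice) + 2 * gamma_choice + 8 / (1 - eps) +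
  16 * expR 1 * v * expR gamma_choice.

Let v8 : 8 <= v.
Proof. by rewrite lerDl divr_ge0 ?sqr_ge0. Qed.

Lemma noise_rate_gt0 : 0 < noise_rate.
Proof. by rewrite divr_gt0 ?expR_gt0// !mulr_gt0 ?exprn_gt0// (lt_le_trans _ v8). Qed.

Let sg0 : 0 <= Num.sqrt gamma_choice. Proof. exact: sqrtr_ge0. Qed.

Lemma large_cutoff_ge : 10 <= large_cutoff.
Proof.
have [e0 e1] := andP eps01.
have : 0 <= (2 * Num.sqrt gamma_choice + `|ln (2 / noise_rate)|) / eps.
  by rewrite divr_ge0 ?(ltW e0)// addr_ge0// mulr_ge0.
by rewrite /large_cutoff /c0_choice; have := sg0; lra.
Qed.

Lemma upper_const_gt0 : 0 < upper_const.
Proof.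
have [e0 e1] := andP eps01; have := large_cutoff_ge.
have : 0 <= Num.sqrt (2 * gamma_choice) by exact: sqrtr_ge0.
have : 0 <= 8 / (1 - eps) by rewrite divr_ge0// subr_ge0 ltW.
have : 0 <= 16 * expR 1 * v * expR gamma_choice.
  by rewrite !mulr_ge0 ?expR_ge0// (le_trans _ v8).
by have := gamma_choice_gt0; rewrite /upper_const; lra.
Qed.

Variables (n d : nat) (f : cube d -> R) (Q : probability (n.-tuple R) R) (K B : R).
Hypotheses (n_gt1 : (1 < n)%N) (d_gt0 : (0 < d)%N).
Hypotheses (K1 : 1 <= K) (B1 : 1 <= B) (fKB : class_KB K B f).
Local Notation s := (Num.sqrt (ln n%:R : R)).
Hypothesis (Ks : K <= s).
Hypothesis (dn : ln d%:R <= (n%:R : R) `^ (1 - eps)).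
Hypothesis (admQ : admissible_noise sigma Q).
Local Notation k := (@degree_cutoff R n gamma_choice c0_choice).

Let f01 : forall x, 0 <= f x <= 1. Proof. by case: fKB => -[]. Qed.
Let fm : cube_monotone f. Proof. by case: fKB => -[]. Qed.
Let IK : total_influence f <= K. Proof. by case: fKB => -[]. Qed.
Let IB : total_influence2 f <= B. Proof. by case: fKB. Qed.
Let sp : 0 < s. Proof. by apply: lt_le_trans Ks; apply: lt_le_trans K1. Qed.
Let s2 : s ^+ 2 = ln n%:R. Proof. by rewrite sqr_sqrtr// ltW// -sqrtr_gt0. Qed.
Let nE : n%:R = expR (s ^+ 2).
Proof. by rewrite s2 lnK// posrE ltr0n ltnW. Qed.

Lemma bias_bound_le : large_cutoff <= s ->
  bias_bound (n := n) gamma_choice c0_choice f <=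
  (Num.sqrt (2 * gamma_choice) + 2 * gamma_choice) * (B / s).
Proof.
move=> ls; have [e0 e1] := andP eps01.
have cs : 2 * c0_choice <= s.
  apply: le_trans ls; rewrite lerDl divr_ge0 ?(ltW e0)// addr_ge0// mulr_ge0//.
have [sk _ _] := degree_cutoff_bounds cs.
set q := Num.sqrt (2 * gamma_choice) in sk *.
have q0 : 0 < q by rewrite sqrtr_gt0 mulr_gt0// gamma_choice_gt0.
have q2 : q ^+ 2 = 2 * gamma_choice by rewrite sqr_sqrtr// mulr_ge0// ltW// gamma_choice_gt0.
have k0 : 0 < k%:R :> R.
  by rewrite ltr0n /degree_cutoff leq_max orbT.
rewrite /bias_bound [leRHS]mulrDl; apply: lerD.
  apply: (@le_trans _ _ (B / (4 * k%:R))).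
    by rewrite ler_wpM2r// invr_ge0 mulr_ge0.
  rewrite [leRHS]mulrCA ler_wpM2l ?(le_trans _ B1)// ler_pdivlMr// mulrC.
  rewrite ler_pdivrMr ?mulr_gt0//; apply: le_trans sk _.
  by rewrite ler_pM2l// ler_peMl ?(ltW k0)// ler1n.
apply: (@le_trans _ _ ((3 ^+ k)^-1 * s)).
  by rewrite ler_wpM2l ?invr_ge0 ?exprn_ge0// (le_trans IK).
apply: (@le_trans _ _ (2 * gamma_choice * (1 / s))); last first.
  by rewrite -q2 ler_wpM2l ?sqr_ge0// ler_pM2r ?invr_gt0.
rewrite mulrC mul1r -q2 ler_pdivlMr// mulrAC ler_pdivrMr ?exprn_gt0//.
rewrite -expr2; apply: (@le_trans _ _ ((q * k%:R) ^+ 2)).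
  by rewrite ler_sqr ?nnegrE ?mulr_ge0// ltW.
by rewrite exprMn ler_wpM2l ?sqr_ge0// sqr_le_exp3.
Qed.

Lemma selection_error_le : large_cutoff <= s ->
  8 * d%:R * expR (- ((@influence_cutoff R n gamma_choice c0_choice / 32) ^+ 2 *
    n./2%:R / (4 * v)))
  <= 8 / (1 - eps) * (1 / s).
Proof.
move=> ls; have [e0 e1] := andP eps01.
have cs : 2 * c0_choice <= s.
  apply: le_trans ls; rewrite lerDl divr_ge0 ?(ltW e0)// addr_ge0// mulr_ge0//.
have [_ _ gk] := degree_cutoff_bounds cs.
have s10 : 10 <= s by exact: le_trans large_cutoff_ge ls.
pose N := expR ((1 - eps) * s ^+ 2).
have NE : (n%:R : R) `^ (1 - eps) = N.
  by rewrite /powR gt_eqF ?ltr0n ?(ltnW n_gt1)// -s2.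
have N0 : 0 < N by exact: expR_gt0.
have dN : d%:R <= expR N.
  by rewrite -NE -[leLHS]lnK ?posrE ?ltr0n// ler_expR.
have Ns : (1 - eps) * s <= N.
  apply: le_trans (expR_ge1Dx _); apply: (@le_trans _ _ ((1 - eps) * s ^+ 2)).
    by rewrite ler_wpM2l; nra.
  by rewrite lerDr.
have rate : 2 * N <=
    (@influence_cutoff R n gamma_choice c0_choice / 32) ^+ 2 * n./2%:R / (4 * v).
  have n4 : n%:R / 4 <= n./2%:R :> R.
    by rewrite ler_pdivrMr// -natrM ler_nat leq_half_mul4.
  have d2 : expR (- (2 * gamma_choice)) * expR (- (2 * Num.sqrt gamma_choice * s)) <=
      @influence_cutoff R n gamma_choice c0_choice ^+ 2.
    rewrite -expRD /influence_cutoff expr2 -expRD ler_expR.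
    by lra.
  have step : noise_rate * (expR (- (2 * Num.sqrt gamma_choice * s)) * n%:R) <=
      (@influence_cutoff R n gamma_choice c0_choice / 32) ^+ 2 * n./2%:R / (4 * v).
    apply: (@le_trans _ _ ((@influence_cutoff R n gamma_choice c0_choice / 32) ^+ 2 *
        (n%:R / 4) / (4 * v))); last first.
      rewrite ler_wpM2r ?invr_ge0 ?mulr_ge0 ?(le_trans _ v8)//.
      by rewrite ler_wpM2l// sqr_ge0.
    rewrite [leLHS](_ : _ = expR (- (2 * gamma_choice)) *
      expR (- (2 * Num.sqrt gamma_choice * s)) * (n%:R / (32 ^+ 2 * 4 * 4 * v))); last first.
      by rewrite /noise_rate; ring.
    rewrite [leRHS](_ : _ = @influence_cutoff R n gamma_choice c0_choice ^+ 2 *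
      (n%:R / (32 ^+ 2 * 4 * 4 * v))); last first.
      have : v != 0 by rewrite gt_eqF// (lt_le_trans _ v8).
      by move: v (influence_cutoff _ _) => u w u0; field.
    by rewrite ler_wpM2r// divr_ge0 ?mulr_ge0 ?(le_trans _ v8).
  apply: le_trans step; have nr0 := noise_rate_gt0.
  set l := `|ln (2 / noise_rate)|.
  have l2 : 2 <= noise_rate * expR l.
    have lE : expR (ln (2 / noise_rate)) = 2 / noise_rate.
      by rewrite lnK// posrE divr_gt0.
    have : expR (ln (2 / noise_rate)) <= expR l by rewrite ler_expR ler_norm.
    by rewrite lE ler_pdivrMr// mulrC.
  have l0 : 0 <= l by exact: normr_ge0.
  have es : 2 * Num.sqrt gamma_choice + l <= s * eps.
    rewrite -ler_pdivrMr//; apply: le_trans ls.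
    by rewrite /large_cutoff lerDr mulr_ge0// ltW// c0_choice_gt0.
  have NEn : expR l * N <= expR (- (2 * Num.sqrt gamma_choice * s)) * n%:R.
    rewrite [X in _ <= _ * X]nE /N -!expRD ler_expR.
    have : (2 * Num.sqrt gamma_choice + l) * s <= s * eps * s by rewrite ler_pM2r.
    have : l <= l * s by rewrite ler_peMr//; lra.
    by rewrite mulrDl -mulrA; lra.
  apply: (@le_trans _ _ (noise_rate * (expR l * N))); last by rewrite ler_pM2l.
  by rewrite mulrA ler_pM2r.
have e1' : 0 < 1 - eps by rewrite subr_gt0.
rewrite -[8 * _ * _]mulrA -[leRHS]mulrA ler_wpM2l// mul1r -invfM.
apply: (@le_trans _ _ (expR (- N))).
  apply: (@le_trans _ _ (expR N * expR (- (2 * N)))).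
    by apply: ler_pM; rewrite ?expR_ge0// ler_expR lerN2.
  by rewrite -expRD ler_expR; lra.
apply: le_trans (expRN_le_inv N0) _.
by rewrite lef_pV2 ?posrE// mulr_gt0.
Qed.

Lemma coef_error_le : large_cutoff <= s ->
  @influence_cutoff R n gamma_choice c0_choice ^- k * expR (4 * K) *
    (8 * expR 1 * v / (n - n./2)%:R) <=
  16 * expR 1 * v * expR gamma_choice * (1 / s).
Proof.
move=> ls; have [e0 e1] := andP eps01.
have cs : 2 * c0_choice <= s.
  apply: le_trans ls; rewrite lerDl divr_ge0 ?(ltW e0)// addr_ge0// mulr_ge0//.
have [_ gk2 _] := degree_cutoff_bounds cs.
have n0 : 0 < n%:R :> R by rewrite ltr0n ltnW.
have nn : n%:R / 2 <= (n - n./2)%:R :> R.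
  by rewrite ler_pdivrMr// -natrM ler_nat; exact: leq_sub_half_mul2.
have n20 : 0 < (n - n./2)%:R :> R by apply: lt_le_trans nn; rewrite divr_gt0.
have -> : @influence_cutoff R n gamma_choice c0_choice ^- k = expR (gamma_choice * k%:R ^+ 2).
  rewrite /influence_cutoff -expRM_natl -expRN; congr expR.
  by ring.
have v0 : 0 < v by apply: lt_le_trans v8.
have ev : 0 <= 8 * expR 1 * v by rewrite !mulr_ge0 ?expR_ge0 ?(ltW v0).
apply: (@le_trans _ _ (expR (gamma_choice * k%:R ^+ 2) * expR (4 * s) *
    (8 * expR 1 * v / (n%:R / 2)))).
  apply: ler_pM; rewrite ?mulr_ge0 ?expR_ge0 ?invr_ge0 ?ler0n ?(ltW v0)//.
    by rewrite ler_wpM2l ?expR_ge0// ler_expR ler_wpM2l.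
  by rewrite ler_wpM2l// lef_pV2 ?posrE ?divr_gt0.
rewrite (_ : _ * _ * _ = 16 * expR 1 * v *
    (expR (gamma_choice * k%:R ^+ 2) * expR (4 * s) * n%:R^-1)); last first.
  by field; rewrite gt_eqF.
rewrite -[leRHS]mulrA ler_wpM2l//; first by rewrite !mulr_ge0 ?expR_ge0 ?(ltW v0).
rewrite [X in _ * X^-1 <= _]nE -expRN -!expRD.
apply: (@le_trans _ _ (expR (gamma_choice - s))).
  by rewrite ler_expR; lra.
by rewrite expRD ler_wpM2l ?expR_ge0// mul1r expRN_le_inv.
Qed.

Lemma fourier_estimator_upper_bound :
  (risk Q (fourier_estimator gamma_choice c0_choice) f <= (upper_const * (B / s))%:E)%E.
Proof.
have sum_le (l x y z t : R) : 0 <= l -> x + y + z + t <= l + x + y + z + t by lra.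
have [e0 e1] := andP eps01.
have q0 : 0 <= Num.sqrt (2 * gamma_choice) by exact: sqrtr_ge0.
have a0 : 0 <= 8 / (1 - eps) by rewrite divr_ge0// subr_ge0 ltW.
have b0 : 0 <= 16 * expR 1 * v * expR gamma_choice.
  by rewrite !mulr_ge0 ?expR_ge0// (le_trans _ v8).
have g0 := gamma_choice_gt0; have l10 := large_cutoff_ge.
have [ls|sl] := leP large_cutoff s; last first.
  apply: le_trans (fourier_estimator_risk_le1 _ _ f01 _) _.
  rewrite lee_fin mulrA ler_pdivlMr// mul1r.
  apply: (@le_trans _ _ (upper_const * 1)); last by rewrite ler_wpM2l// ltW// upper_const_gt0.
  by rewrite mulr1 /upper_const; lra.
have n_gt2 : (2 < n)%N.
  rewrite -(ltr_nat R) nE; apply: lt_le_trans (expR_ge1Dx _).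
  by rewrite -[X in X < _]/(2%:R); nra.
apply: le_trans (fourier_estimator_risk_le f01 fm n_gt2
  (influence_cutoff_gamma_choice n) admQ IK) _.
rewrite lee_fin.
have Bs : 1 / s <= B / s by rewrite ler_pM2r// invr_gt0.
have T1 := bias_bound_le ls; have T2 := selection_error_le ls.
have T3 := coef_error_le ls.
have T2' := le_trans T2 (ler_wpM2l a0 Bs).
have T3' := le_trans T3 (ler_wpM2l b0 Bs).
apply: (le_trans (lerD (lerD T1 T2') T3')).
rewrite -!mulrDl ler_wpM2r ?divr_ge0 ?(le_trans _ B1) ?(ltW sp)//.
by apply: sum_le; rewrite (le_trans _ l10).
Qed.

End Upper.
End Asymptotics.

(** * The lower bound *)

Section CentralBinomial.
Context {R : realType}.

Definition central_mass (m : nat) : R := 'C(2 * m, m)%:R / 2 ^+ (2 * m).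

Lemma central_mass0 : central_mass 0 = 1.
Proof. by rewrite /central_mass muln0 bin0 expr0 divr1. Qed.

Lemma central_massS m :
  central_mass m.+1 * (2 * m.+1%:R) = central_mass m * (2 * m%:R + 1).
Proof.
have binE : ('C(2 * m.+1, m.+1) * m.+1 = 2 * ((2 * m).+1 * 'C(2 * m, m)))%N.
  have := mul_bin_diag (2 * m).+2 m; have := mul_bin_down (2 * m).+1 m.
  rewrite (_ : 2 * m.+1 = (2 * m).+2)%N; last by lia.
  rewrite (_ : (2 * m).+1 - m = m.+1)%N; last by lia.
  move=> /= -> e; rewrite mulnC -e; lia.
have expE : 2 ^+ (2 * m.+1) = 4 * 2 ^+ (2 * m) :> R.
  by rewrite mulnS exprD; congr (_ * _); ring.
have e2 : 2 ^+ (2 * m) != 0 :> R by rewrite expf_neq0// pnatr_eq0.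
rewrite /central_mass expE.
have : 'C(2 * m.+1, m.+1)%:R * m.+1%:R = 2 * ((2 * m%:R + 1) * 'C(2 * m, m)%:R) :> R.
  by rewrite -natrM binE !natrM -[(2 * m).+1%:R]natr1 natrM.
move: ('C(_, m.+1)%:R) ('C(_, m)%:R) (m.+1%:R) (m%:R) (2 ^+ _) e2 => c c' m1 m' e e0 h.
have -> : c / (4 * e) * (2 * m1) = c * m1 / (2 * e) by field.
by rewrite h; field.
Qed.

Lemma central_mass_ge0 m : 0 <= central_mass m.
Proof. by rewrite divr_ge0 ?ler0n ?exprn_ge0. Qed.

Lemma central_mass_le m : central_mass m ^+ 2 * (2 * m%:R + 1) <= 1.
Proof.
elim: m => [|m IH]; first by rewrite central_mass0; lra.
have m0 : 0 <= m%:R :> R by rewrite ler0n.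
have := central_massS m; rewrite -[m.+1%:R]natr1; move: IH m0.
move: (central_mass m.+1) (central_mass m) (m%:R : R) => c' c x IH x0 cE.
have x1 : 0 < (2 * (x + 1)) ^+ 2 by rewrite exprn_gt0//; lra.
rewrite -(ler_pM2r x1) mul1r.
have -> : c' ^+ 2 * (2 * (x + 1) + 1) * (2 * (x + 1)) ^+ 2 =
    (c' * (2 * (x + 1))) ^+ 2 * (2 * x + 3) by ring.
rewrite cE (_ : _ * _ = c ^+ 2 * (2 * x + 1) * ((2 * x + 1) * (2 * x + 3))); last ring.
apply: (@le_trans _ _ (1 * ((2 * x + 1) * (2 * x + 3)))); last by rewrite mul1r; nra.
by rewrite ler_wpM2r// mulr_ge0//; lra.
Qed.

Lemma central_mass_ge m : (0 < m)%N -> 1 <= central_mass m ^+ 2 * (4 * m%:R).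
Proof.
elim: m => // -[_ _|m IH _].
  by rewrite /central_mass muln1 bin1; lra.
have m0 : 0 < m.+1%:R :> R by rewrite ltr0n.
have := central_massS m.+1; rewrite -[m.+2%:R]natr1; move: (IH isT) m0.
move: (central_mass m.+2) (central_mass m.+1) (m.+1%:R : R) => c' c x {}IH x0 cE.
have x1 : 0 < (2 * (x + 1)) ^+ 2 by rewrite exprn_gt0//; lra.
rewrite -(ler_pM2r x1) mul1r.
have -> : c' ^+ 2 * (4 * (x + 1)) * (2 * (x + 1)) ^+ 2 =
    (c' * (2 * (x + 1))) ^+ 2 * (4 * (x + 1)) by ring.
rewrite cE; apply: (@le_trans _ _ (c ^+ 2 * (4 * x) * (2 * (x + 1)) ^+ 2)).
  by rewrite ler_peMl// ltW.
rewrite -subr_ge0 [X in 0 <= X](_ : _ = c ^+ 2 * (4 * (x + 1))); last by ring.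
by rewrite mulr_ge0 ?sqr_ge0//; lra.
Qed.

End CentralBinomial.

Section LayerFunctions.
Context {R : realType} {d : nat}.
Variable m : nat.
Hypothesis kd : (2 * m <= d)%N.
Local Notation k := (2 * m)%N.
Implicit Types (x y : cube d) (i : 'I_d) (omega : {set {set 'I_d}}).

Definition head_support x : {set 'I_d} := [set i : 'I_d | (i < k)%N && tnth x i]%SET.

Definition middle_layer x : bool := #|head_support x| == m.

Definition layer_bool omega x : bool :=
  (m < #|head_support x|)%N || (middle_layer x && (head_support x \in omega)).

Definition layer_fun (a : R) omega x : R := a * (layer_bool omega x)%:R.

Lemma layer_bool_monotone omega x y : cube_le x y ->
  layer_bool omega x -> layer_bool omega y.
Proof.
move=> xy; have sub : head_support x \subset head_support y.
  apply/fintype.subsetP => i; rewrite !inE => /andP[-> /=] xi.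
  by move: (xy i); rewrite xi.
have le := subset_leq_card sub.
case/orP => [mx|/andP[/eqP xm xo]]; first by rewrite /layer_bool (leq_trans mx le).
rewrite /layer_bool /middle_layer -{1}xm ltn_neqAle le andbT.
case: eqP => //= e.
have/eqP <- : head_support x == head_support y by rewrite eqEcard sub e leqnn.
by rewrite xm eqxx xo.
Qed.

Lemma layer_fun_monotone a omega : 0 <= a -> cube_monotone (layer_fun a omega).
Proof.
move=> a0 x y xy; rewrite ler_wpM2l// ler_nat.
by have := layer_bool_monotone (omega := omega) xy; case: (layer_bool omega x) => // ->.
Qed.

Lemma layer_fun_itv a omega x : 0 <= a <= 1 -> 0 <= layer_fun a omega x <= 1.
Proof. by rewrite /layer_fun; case: (layer_bool _ _); rewrite ?mulr1// mulr0 lexx ler01. Qed.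

Lemma head_support_set_coord_out x i b : (k <= i)%N ->
  head_support (set_coord x i b) = head_support x.
Proof.
move=> ki; apply/setP => j; rewrite !inE tnth_mktuple; case: eqP => // ->.
by rewrite ltnNge ki.
Qed.

Lemma card_head_support_set_coord x i : (i < k)%N ->
  #|head_support (set_coord x i true)| = #|head_support (set_coord x i false)|.+1.
Proof.
move=> ik; rewrite (cardsD1 i) inE ik tnth_mktuple eqxx /= add1n; congr _.+1.
apply: eq_card => j; rewrite !inE !tnth_mktuple.
by case: eqP => //=; rewrite andbF.
Qed.

Lemma layer_bool_diff_le omega x i :
  `|(layer_bool omega (set_coord x i true))%:R - (layer_bool omega (set_coord x i false))%:R|
  <= (i < k)%N%:R * ((middle_layer (set_coord x i true))%:R +
                     (middle_layer (set_coord x i false))%:R) :> R.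
Proof.
case: ltnP => [ik|ki]; last first.
  by rewrite !/layer_bool !/middle_layer !head_support_set_coord_out// subrr normr0 mul0r.
rewrite mul1r; have e := card_head_support_set_coord x ik.
have [M|nM] := boolP (middle_layer (set_coord x i true) || middle_layer (set_coord x i false)).
  apply: (@le_trans _ _ 1).
    case: (layer_bool _ _); case: (layer_bool _ _);
    by rewrite ?subrr ?sub0r ?subr0 ?normrN ?normr0 ?normr1.
  by case/orP: M => ->; rewrite ?lerDl ?lerDr ler0n.
have -> : layer_bool omega (set_coord x i true) = layer_bool omega (set_coord x i false).
  move: nM; rewrite negb_or => /andP[n1 n2].
  rewrite /layer_bool (negPf n1) (negPf n2) !orbF e ltnS leq_eqVlt.
  by rewrite eq_sym [_ == m](negPf n2).
by rewrite subrr normr0 addr_ge0 ?ler0n.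
Qed.

Definition layer_mass : R := cube_mean (fun x => (middle_layer x)%:R).

Lemma layer_mean_le i : cube_mean (fun x =>
  (middle_layer (set_coord x i true))%:R + (middle_layer (set_coord x i false))%:R)
  = 2 * layer_mass.
Proof.
rewrite cube_meanD -!/(face_mean (fun x => (middle_layer x)%:R : R) i _) !face_mean_indic.
rewrite -mulrDr -cube_meanD; congr (_ * _); apply: eq_cube_mean => x.
by case: (tnth x i); rewrite /= ?mulr1 ?mulr0 ?addr0 ?add0r.
Qed.

Lemma card_lt_ord : #|[set i : 'I_d | (i < k)%N]%SET| = k.
Proof.
rewrite -sum1_card; under eq_bigl do rewrite inE.
by rewrite (big_ord_narrow kd) sum_nat_const card_ord muln1.
Qed.

Lemma sum_lt_ord (c : R) : \sum_(i < d) (i < k)%N%:R * c = k%:R * c.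
Proof.
rewrite -mulr_suml -natr_sum; congr (_%:R * _).
rewrite -[RHS]card_lt_ord -sum1_card [RHS]big_mkcond; apply: eq_bigr => i _.
by rewrite inE; case: ltnP.
Qed.

Lemma layer_fun_influence a omega : 0 <= a ->
  total_influence (layer_fun a omega) <= 2 * k%:R * a * layer_mass.
Proof.
move=> a0; apply: (@le_trans _ _ (\sum_(i < d) (i < k)%N%:R * (a * (2 * layer_mass)))).
  apply: ler_sum => i _; rewrite -(layer_mean_le i) -!cube_meanZ.
  apply: ler_cube_mean => x; rewrite /cube_diff /layer_fun -mulrBr normrM ger0_norm//.
  by rewrite [leRHS]mulrCA ler_wpM2l// layer_bool_diff_le.
by rewrite sum_lt_ord le_eqVlt; apply/predU1l; ring.
Qed.

Lemma layer_fun_influence2 a omega :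
  total_influence2 (layer_fun a omega) <= 2 * k%:R * a ^+ 2 * layer_mass.
Proof.
apply: (@le_trans _ _ (\sum_(i < d) (i < k)%N%:R * (a ^+ 2 * (2 * layer_mass)))).
  apply: ler_sum => i _; rewrite -(layer_mean_le i) -!cube_meanZ.
  apply: ler_cube_mean => x; rewrite /cube_diff /layer_fun -mulrBr exprMn.
  rewrite [leRHS]mulrCA ler_wpM2l ?sqr_ge0//; apply: le_trans (layer_bool_diff_le omega x i).
  case: (layer_bool _ _); case: (layer_bool _ _);
  by rewrite ?subrr ?sub0r ?subr0 ?sqrrN ?normrN ?normr0 ?normr1 ?expr0n ?expr1n.
by rewrite sum_lt_ord le_eqVlt; apply/predU1l; ring.
Qed.

Lemma head_support_mass (A : {set 'I_d}) : A \subset [set i : 'I_d | (i < k)%N]%SET ->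
  cube_mean (fun x => (head_support x == A)%:R) = 2^-1 ^+ k :> R.
Proof.
move=> Ak; pose G i (b : bool) : R := if (i < k)%N then (b == (i \in A))%:R else 1.
have GE x : (head_support x == A)%:R = \prod_i G i (tnth x i).
  have [e|ne] := eqVneq (head_support x) A.
    rewrite big1// => i _; rewrite /G; case: ifP => // ik.
    by rewrite -e inE ik eqxx.
  apply/esym/eqP/prodf_eq0.
  have [i ni] : exists i, (i \in head_support x) != (i \in A).
    apply/existsP; apply: contraNT ne => /existsPn ne; apply/eqP/setP => i.
    by apply/eqP; have := ne i; rewrite negbK.
  exists i => //; rewrite /G; case: ifP => ik.
    by move: ni; rewrite inE ik /= => /negPf ->.
  move: ni; rewrite inE ik/= => iA; have := fintype.subsetP Ak i.
  by move: iA; case: (i \in A) => // _ /(_ isT); rewrite inE ik.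
rewrite /cube_mean; under eq_bigr do rewrite GE.
rewrite tuple_sum_prod.
have -> : \prod_(i < d) \sum_t G i t = \prod_(i < d) (2 * (if (i < k)%N then 2^-1 else 1)).
  apply: eq_bigr => i _; rewrite big_bool /G; case: ifP => _; last by rewrite mulr1.
  by case: (i \in A) => /=; field.
rewrite big_split/= prodr_const card_ord mulKf ?expf_neq0//.
rewrite -big_mkcond/=.
have -> : \prod_(i < d | (i < k)%N) (2^-1 : R) =
    \prod_(i in [set i : 'I_d | (i < k)%N]%SET) 2^-1.
  by apply: eq_bigl => i; rewrite inE.
by rewrite prodr_const card_lt_ord.
Qed.

Lemma layer_massE : layer_mass = central_mass m.
Proof.
pose H := [set i : 'I_d | (i < k)%N]%SET.
pose L := [set A : {set 'I_d} | A \subset H & #|A| == m]%SET.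
have sH x : head_support x \subset H.
  by apply/fintype.subsetP => i; rewrite !inE => /andP[].
have -> : layer_mass = cube_mean (fun x => \sum_(A in L) (head_support x == A)%:R).
  apply: eq_cube_mean => x; have [M|nM] := boolP (middle_layer x).
    rewrite (bigD1 (head_support x))/=; last by rewrite inE sH.
    rewrite eqxx big1 ?addr0// => A /andP[_ /negPf]; by rewrite eq_sym => ->.
  rewrite big1// => A; rewrite inE => /andP[_ Am].
  by case: eqP => // e; move: nM; rewrite /middle_layer e Am.
rewrite cube_mean_sum (eq_bigr (fun=> 2^-1 ^+ k)); last first.
  by move=> A; rewrite inE => /andP[AH _]; exact: head_support_mass.
by rewrite sumr_const cards_draws card_lt_ord exprVn -[_ *+ _]mulr_natl.
Qed.

End LayerFunctions.

Section NoiselessRisk.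
Context {R : realType} {d n : nat}.

Definition noiseless : probability (n.-tuple R) R := \d_ [tuple (0 : R) | j < n].

Lemma noiseless_admissible (sigma : R) : admissible_noise sigma noiseless.
Proof.
have mt j : measurable_fun [set: n.-tuple R] (fun e => tnth e j).
  exact: measurable_tnth.
have nE (A : set (n.-tuple R)) :
    noiseless A = (([tuple 0 | j < n] \in A)%:R)%:E by exact: diracE.
split.
- move=> J B mB; rewrite nE.
  have [H|] := boolP [forall j in J, 0 \in B j].
    rewrite mem_set; last first.
      move=> j jJ /=; rewrite tnth_mktuple.
      by have /forallP/(_ j)/implyP/(_ jJ) := H; rewrite inE.
    rewrite big1// => j jJ; rewrite nE mem_set//= tnth_mktuple.
    by have /forallP/(_ j)/implyP/(_ jJ) := H; rewrite inE.
  move=> /forallPn[j]; rewrite negb_imply => /andP[jJ nB].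
  rewrite memNset; last first.
    by move=> /(_ j jJ) /=; rewrite tnth_mktuple => Bj; move/negP: nB; apply; rewrite inE.
  rewrite (bigD1 j)//= nE memNset ?mul0e//= tnth_mktuple => Bj.
  by move/negP: nB; apply; rewrite inE.
- move=> j; rewrite unlock integral_dirac//; last exact/measurable_EFinP.
  by rewrite diracT mul1e tnth_mktuple.
- move=> j t; rewrite /mmt_gen_fun unlock integral_dirac//; last first.
    apply/measurable_EFinP; apply: measurableT_comp => //.
    by apply: measurable_funM.
  rewrite diracT mul1e /= tnth_mktuple mul0r expR0 lee_fin.
  apply: le_trans (expR_ge1Dx _).
  by rewrite lerDl divr_ge0// mulr_ge0 ?sqr_ge0.
Qed.

Definition noiseless_sample (f : cube d -> R) (X : n.-tuple (cube d)) : sample R d n :=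
  regression_sample f (X, [tuple 0 | j < n]).

Lemma measurable_regression_sample (f : cube d -> R) :
  measurable_fun [set: n.-tuple (cube d) * n.-tuple R] (regression_sample f).
Proof.
apply/measurable_fun_tnthP => j.
have -> : (@tnth n (cube d * R)%type)^~ j \o regression_sample f =
    (fun w => (tnth w.1 j, f (tnth w.1 j) + tnth w.2 j)).
  by apply/funext => w /=; rewrite tnth_mktuple.
have m1 dT (T : measurableType dT) (h : cube d -> T) :
    measurable_fun [set: n.-tuple (cube d) * n.-tuple R] (fun w => h (tnth w.1 j)).
  apply: (measurableT_comp (f := fun x => h (tnth x j))) => //.
  exact: measurable_fun_design.
apply: measurable_fun_pair; first exact: (m1 _ _ id).
apply: measurable_funD; first exact: m1.
apply: (measurableT_comp (f := fun x : n.-tuple R => tnth x j)) => //.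
exact: measurable_tnth.
Qed.

Lemma noiseless_risk (est : sample R d n -> cube d -> R) (f : cube d -> R) :
  is_estimator est -> risk noiseless est f =
  ((2 ^+ (d * n))^-1 * \sum_(X : n.-tuple (cube d))
     l2normsq (fun x => est (noiseless_sample f X) x - f x))%:E.
Proof.
move=> mest; rewrite /risk unlock.
set F := (X in (\int[_]_w (X w)%:E)%E).
have mF : measurable_fun setT F.
  apply: measurable_funM => //; apply: measurable_sum => x.
  apply: measurable_funX; apply: measurable_funB => //.
  apply: (measurableT_comp (f := fun D => est D x)) => //.
  exact: measurable_regression_sample.
have F0 w : 0 <= F w by apply: cube_mean_ge0 => x; exact: sqr_ge0.
have mEF : measurable_fun setT (fun w => (F w)%:E) by exact/measurable_EFinP.
rewrite fubini_tonelli1//.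
rewrite integral_design_law; last first.
  by move=> X; apply: integral_ge0 => e _; rewrite lee_fin.
rewrite EFinM -sumEFin; congr (_ * _)%E; apply: eq_bigr => X _.
rewrite /fubini_F integral_dirac//; first by rewrite diracT mul1e.
by apply: (measurableT_comp mEF); exact: measurable_fun_pair.
Qed.

End NoiselessRisk.

Section BayesRisk.
Context {R : realType} {d n m : nat}.
Hypothesis kd : (2 * m <= d)%N.
Hypothesis n_small : n%:R / 2 ^+ (2 * m) <= 1 / 2 :> R.
Variables (a : R) (est : sample R d n -> cube d -> R).
Implicit Types (x y : cube d) (X : n.-tuple (cube d)) (omega : {set {set 'I_d}}).

Definition unseen X x : bool :=
  [forall j, head_support m (tnth X j) != head_support m x].

Definition toggle (T : {set 'I_d}) omega : {set {set 'I_d}} :=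
  if T \in omega then (omega :\ T)%SET else (T |: omega)%SET.

Lemma toggleK T : involutive (toggle T).
Proof.
move=> omega; rewrite /toggle; case: (boolP (T \in omega)) => To.
  by rewrite setD11 finset.setD1K.
by rewrite finset.setU11 finset.setU1K.
Qed.

Lemma in_toggle T omega : (T \in toggle T omega) = (T \notin omega).
Proof. by rewrite /toggle; case: ifP => To; rewrite !inE eqxx. Qed.

Lemma in_toggle_neq T S omega : S != T -> (S \in toggle T omega) = (S \in omega).
Proof. by move=> /negPf ST; rewrite /toggle; case: ifP => To; rewrite !inE ST. Qed.

Lemma toggle_sample X x omega : unseen X x ->
  noiseless_sample (layer_fun m a (toggle (head_support m x) omega)) X =
  noiseless_sample (layer_fun m a omega) X.
Proof.
move=> /forallP un; apply: eq_from_tnth => j; rewrite !tnth_mktuple /=.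
by rewrite /layer_fun /layer_bool in_toggle_neq.
Qed.

(* Toggling whether head_support x belongs to omega does not change the sample,
   but moves f x between 0 and a. *)
Lemma pointwise_bayes_risk X x : middle_layer m x -> unseen X x ->
  #|{: {set {set 'I_d}}}|%:R * (a ^+ 2 / 4) <=
  \sum_omega (est (noiseless_sample (layer_fun m a omega) X) x - layer_fun m a omega x) ^+ 2.
Proof.
move=> Mx un; pose F omega :=
  (est (noiseless_sample (layer_fun m a omega) X) x - layer_fun m a omega x) ^+ 2.
suff : #|{: {set {set 'I_d}}}|%:R * (a ^+ 2 / 2) <= 2 * \sum_omega F omega by lra.
rewrite [leRHS](_ : _ = \sum_omega F omega + \sum_omega F omega); last by ring.
rewrite [X in _ + X](reindex_inj (inv_inj (toggleK (head_support m x)))).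
rewrite -big_split/= mulr_natl -sumr_const; apply: ler_sum => omega _.
rewrite /F toggle_sample//; set e := est _ _.
rewrite /layer_fun /layer_bool Mx in_toggle /=.
have -> : (m < #|head_support m x|)%N = false by move/eqP: Mx => ->; rewrite ltnn.
by case: (_ \in omega); rewrite /= ?mulr1 ?mulr0 ?subr0; have := sqr_ge0 (2 * e - a); nra.
Qed.

Lemma unseen_mass x : (#|head_support m x| == m) ->
  1 / 2 <= (2 ^+ (d * n))^-1 * \sum_X (unseen X x)%:R :> R.
Proof.
move=> xm; pose G (y : cube d) : R := (head_support m y != head_support m x)%:R.
have UE X : (unseen X x)%:R = \prod_(j < n) G (tnth X j).
  have [/forallP un|/forallPn[j nu]] := boolP (unseen X x).
    by rewrite big1// => j _; rewrite /G un.
  by rewrite (bigD1 j)//= /G (negPf nu) mul0r.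
under eq_bigr do rewrite UE.
have -> := design_sum_prod (fun _ : 'I_n => G); rewrite prodr_const card_ord.
have -> : cube_mean G = 1 - 2^-1 ^+ (2 * m).
  rewrite -(head_support_mass kd (A := head_support m x)); last first.
    by apply/fintype.subsetP => i; rewrite !inE => /andP[].
  rewrite -[X in X - _](@cube_mean_cst R d 1) -cube_meanB; apply: eq_cube_mean => y.
  by rewrite /G; case: eqP; rewrite ?subrr ?subr0.
set q := 2^-1 ^+ _; have q1 : 0 <= q <= 1.
  by rewrite exprn_ge0 ?exprn_ile1//; lra.
have bern : 1 - n%:R * q <= (1 - q) ^+ n.
  elim: (n) => [|N IH]; first by rewrite mul0r subr0 expr0.
  rewrite exprS -natr1; have N0 : 0 <= N%:R :> R by rewrite ler0n.
  move: (N%:R) N0 ((1 - q) ^+ N) IH => u u0 w uw; nra.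
by move: n_small; rewrite -exprVn -/q; lra.
Qed.

Lemma bayes_risk : #|{: {set {set 'I_d}}}|%:R * (a ^+ 2 * central_mass m / 8) <=
  \sum_omega (2 ^+ (d * n))^-1 * \sum_(X : n.-tuple (cube d)) l2normsq (fun x =>
     est (noiseless_sample (layer_fun m a omega) X) x - layer_fun m a omega x).
Proof.
set N := #|_|%:R; have N0 : 0 <= N by rewrite ler0n.
rewrite -mulr_sumr exchange_big/=.
pose c : R := (2 ^+ (d * n))^-1; have c0 : 0 < c by rewrite invr_gt0 exprn_gt0.
have lower X : cube_mean (fun x => (middle_layer m x && unseen X x)%:R * (N * (a ^+ 2 / 4)))
   <= \sum_omega l2normsq (fun x =>
     est (noiseless_sample (layer_fun m a omega) X) x - layer_fun m a omega x).
  rewrite /l2normsq -cube_mean_sum; apply: ler_cube_mean => x.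
  case: (boolP (_ && _)) => [/andP[Mx un]|_]; rewrite ?mul1r ?mul0r.
    exact: pointwise_bayes_risk.
  by apply: sumr_ge0 => omega _; exact: sqr_ge0.
apply: (@le_trans _ _ (c * \sum_X cube_mean (fun x =>
    (middle_layer m x && unseen X x)%:R * (N * (a ^+ 2 / 4))))); last first.
  by rewrite ler_pM2l//; apply: ler_sum => X _.
rewrite -cube_mean_sum -cube_meanZ.
apply: (@le_trans _ _ (cube_mean (fun x => (N * (a ^+ 2 / 8)) * (middle_layer m x)%:R))).
  by rewrite cube_meanZ -/(layer_mass m) layer_massE//; lra.
apply: ler_cube_mean => x; rewrite -mulr_suml.
case: (boolP (middle_layer m x)) => Mx; last first.
  rewrite mulr0; apply: mulr_ge0; first exact: ltW.
  apply: mulr_ge0; first by apply: sumr_ge0 => X _; rewrite ler0n.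
  by rewrite mulr_ge0// divr_ge0// sqr_ge0.
have := unseen_mass Mx; rewrite -/c /=.
have : 0 <= N * (a ^+ 2 / 4) by rewrite mulr_ge0// divr_ge0// sqr_ge0.
move=> h0 h1; rewrite mulr1 [leRHS]mulrA.
rewrite [leLHS](_ : _ = 1 / 2 * (N * (a ^+ 2 / 4))); last by field.
exact: ler_wpM2r.
Qed.

End BayesRisk.

Section LowerBound.
Context {R : realType}.

Lemma ln2_bounds : 1 / 2 <= (ln 2 : R) <= 1.
Proof.
apply/andP; split.
  rewrite -ler_expR lnK ?posrE//.
  have := expR_ge1Dx (- (1 / 2) : R).
  rewrite expRN => h; rewrite -[leLHS]invrK -[leRHS]invrK.
  by rewrite lef_pV2 ?posrE ?invr_gt0 ?expR_gt0//; lra.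
by rewrite -ler_expR lnK ?posrE//; have := expR_ge1Dx (1 : R); lra.
Qed.

(* The middle layer of [2 * half_dim n] coordinates has more points than the
   sample can see, while [half_dim n] is comparable to [ln n]. *)
Definition half_dim (n : nat) : nat := (trunc_log 2 n).+1.

Lemma half_dim_bounds n : (1 < n)%N ->
  [/\ ln n%:R <= (half_dim n)%:R :> R, (half_dim n)%:R <= 4 * ln n%:R :> R
    & n%:R / 2 ^+ (2 * half_dim n) <= 1 / 2 :> R].
Proof.
move=> n1; have n0 : (0 < n)%N by exact: ltnW.
have /andP[lo hi] := trunc_log_bounds (isT : (1 < 2)%N) n0.
have t1 : (0 < trunc_log 2 n)%N by rewrite trunc_log_gt0 n1.
have /andP[l2 l2'] := ln2_bounds.
have lnX j : ln ((2 ^ j)%N%:R : R) = j%:R * ln 2 by rewrite natrX lnXn// mulr_natl.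
have L0 : (trunc_log 2 n)%:R * ln 2 <= ln n%:R :> R.
  by rewrite -lnX ler_ln ?posrE ?ltr0n ?expn_gt0// ler_nat.
have L1 : ln n%:R <= (half_dim n)%:R * ln 2 :> R.
  by rewrite -lnX ler_ln ?posrE ?ltr0n ?expn_gt0// ler_nat ltnW.
have t1' : 1 <= (trunc_log 2 n)%:R :> R by rewrite ler1n.
split.
- by apply: le_trans L1 _; rewrite ler_piMr ?ler0n.
- by rewrite /half_dim -natr1; nra.
rewrite ler_pdivrMr ?exprn_gt0//; apply: (@le_trans _ _ (2 ^+ half_dim n)).
  by rewrite -natrX ler_nat ltnW.
rewrite mulnC exprM expr2 mulrA ler_peMl ?exprn_ge0//.
by rewrite exprS; have : 1 <= 2 ^+ trunc_log 2 n :> R by [rewrite exprn_ege1// ler1n]; lra.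
Qed.

Lemma minimax_lower_bound (sigma K B : R) (n d : nat) (c : R)
    (s := Num.sqrt (ln n%:R)) (est : sample R d n -> cube d -> R) :
  0 < c -> 32 * (32 * c) <= 1 -> (1 < n)%N -> 0 < K -> K <= c * s -> 0 < B -> B <= K ^+ 2 / s ->
  c^-1 * ln n%:R <= d%:R -> is_estimator est ->
  exists (f : cube d -> R) (Q : probability (n.-tuple R) R),
    [/\ class_KB K B f, admissible_noise sigma Q
      & ((c * (B / ln n%:R))%:E <= risk Q est f)%E].
Proof.
move=> c0 c32 n1 K0 Kc B0 BK Ld mest; pose m := half_dim n.
have [Lm mL nm] := half_dim_bounds n1.
have L0 : 0 < ln n%:R :> R by rewrite ln_gt0// ltr1n.
have s0 : 0 < s by rewrite sqrtr_gt0.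
have s2 : s ^+ 2 = ln n%:R by rewrite sqr_sqrtr// ltW.
have kd : (2 * m <= d)%N.
  rewrite -(ler_nat R); apply: le_trans Ld; rewrite natrM.
  apply: (@le_trans _ _ (8 * ln n%:R)); first by move: mL; rewrite -/m; lra.
  by rewrite ler_pM2r// -[leLHS]invrK lef_pV2 ?posrE ?invr_gt0//; lra.
pose p : R := central_mass m; pose M := m%:R * p.
have m0 : 1 <= m%:R :> R by rewrite ler1n.
have p0 : 0 <= p by exact: central_mass_ge0.
have M0 : 0 <= M by rewrite mulr_ge0.
have Mhi : M <= 2 * s.
  rewrite -ler_sqr ?nnegrE ?mulr_ge0 ?(ltW s0)//.
  have := central_mass_le (R := R) m; rewrite -/p => pm.
  have : M ^+ 2 <= m%:R.
    by rewrite exprMn; have := sqr_ge0 p; move: (p ^+ 2) pm => q; nra.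
  move=> /le_trans; apply; rewrite exprMn s2; move: mL; rewrite -/m; lra.
have Mlo : s / 2 <= M.
  rewrite -ler_sqr ?nnegrE ?divr_ge0 ?(ltW s0)//.
  have := central_mass_ge (R := R) (isT : (0 < m)%N); rewrite -/p => pm.
  have : m%:R / 4 <= M ^+ 2.
    by rewrite exprMn; have := sqr_ge0 p; move: (p ^+ 2) pm => q; nra.
  by apply: le_trans; rewrite exprMn s2; move: Lm; rewrite -/m; lra.
have Mp : 0 < M by apply: lt_le_trans Mlo; rewrite divr_gt0.
have c1 : c <= 1 by lra.
have Bs : B * s <= K ^+ 2 by rewrite -ler_pdivlMr.
have Bs' : B <= s.
  have : K ^+ 2 <= s ^+ 2.
    rewrite ler_sqr ?nnegrE ?(ltW K0) ?(ltW s0)//; apply: le_trans Kc _.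
    by rewrite ler_piMl// ltW.
  by move=> /(le_trans Bs); rewrite expr2 ler_pM2r.
pose a := Num.sqrt (B / (32 * M)).
have a0 : 0 <= a by exact: sqrtr_ge0.
have a2 : a ^+ 2 = B / (32 * M) by rewrite sqr_sqrtr// divr_ge0 ?mulr_ge0 ?(ltW B0).
have aM : a ^+ 2 * M = B / 32 by rewrite a2; field; rewrite gt_eqF.
have a1 : a <= 1.
  have M32 : 0 < 32 * M by lra.
  have : a ^+ 2 <= 1 by rewrite a2 (ler_pdivrMr _ _ M32); lra.
  by rewrite -[X in _ <= X -> _](expr1n _ 2) ler_sqr// nnegrE.
have cls omega : class_KB K B (layer_fun m a omega : cube d -> R).
  split; first split.
  - by move=> x; apply: layer_fun_itv; rewrite a0.
  - exact: layer_fun_monotone.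
  - apply: le_trans (layer_fun_influence kd omega a0) _.
    rewrite layer_massE// natrM -/p [leLHS](_ : _ = 4 * (a * M)); last by rewrite /M; ring.
    rewrite -ler_sqr ?nnegrE ?mulr_ge0 ?(ltW K0)//.
    rewrite (_ : _ ^+ 2 = 16 * (a ^+ 2 * M) * M); last by ring.
    by rewrite aM; nra.
  apply: le_trans (layer_fun_influence2 kd a omega) _.
  rewrite layer_massE// natrM -/p [leLHS](_ : _ = 4 * (a ^+ 2 * M)); last by rewrite /M; ring.
  by rewrite aM; lra.
pose r omega : R := (2 ^+ (d * n))^-1 * \sum_(X : n.-tuple (cube d)) l2normsq (fun x =>
     est (noiseless_sample (layer_fun m a omega) X) x - layer_fun m a omega x).
have [omega romega] : exists omega, a ^+ 2 * p / 8 <= r omega.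
  have [omega _ rmax] := @arg_maxP _ _ _ finset.set0 xpredT r isT.
  exists omega; rewrite -(ler_pM2l (x := #|{: {set {set 'I_d}}}|%:R)); last first.
    by rewrite ltr0n; apply/card_gt0P; exists omega.
  apply: le_trans (bayes_risk kd nm a est) _.
  by rewrite mulr_natl -sumr_const; apply: ler_sum => o _; exact: rmax.
exists (layer_fun m a omega), noiseless; split => //.
  exact: noiseless_admissible.
rewrite noiseless_risk// lee_fin; apply: le_trans romega.
rewrite -(@ler_pM2r _ m%:R)//.
rewrite (_ : a ^+ 2 * p / 8 * _ = a ^+ 2 * M / 8); last by rewrite /M; ring.
rewrite aM mulrA mulrAC ler_pdivrMr//.
have Bm : c * (B * m%:R) <= c * (B * (4 * ln n%:R)) by rewrite !ler_pM2l.
have : (32 * (32 * c)) * (B * ln n%:R) <= B * ln n%:R by rewrite ler_piMl// mulr_ge0// ltW.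
by move: Bm; move: (ln n%:R) (m%:R) => l m'; lra.
Qed.

End LowerBound.

Theorem theorem2p2 (R : realType) :
  exists gamma c0 : R, 2 * ln 3 < gamma /\ 0 < c0 /\
  forall sigma : R, 0 < sigma ->
  forall epsilon : R, 0 < epsilon < 1 ->
  exists c C : R, 0 < c /\ 0 < C /\
  forall n d : nat, (2 <= n)%N -> (1 <= d)%N ->
  (forall K B : R,
     1 <= K -> K <= Num.sqrt (ln n%:R) ->
     1 <= B -> B <= K ->
     ln d%:R <= n%:R `^ (1 - epsilon) ->
     forall Q : probability (n.-tuple R) R, admissible_noise sigma Q ->
     (ereal_sup [set risk Q (fourier_estimator gamma c0) f
                | f in (class_KB K B : set (cube d -> R))]
      <= (C * (B / Num.sqrt (ln n%:R)))%:E)%E)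
  /\
  (forall K B : R,
     0 < K -> K <= c * Num.sqrt (ln n%:R) ->
     0 < B -> B <= K ^+ 2 / Num.sqrt (ln n%:R) ->
     c^-1 * ln n%:R <= d%:R ->
     ((c * (B / ln n%:R))%:E <=
      ereal_inf [set ereal_sup [set r | exists (f : cube d -> R)
                                               (Q : probability (n.-tuple R) R),
                                  [/\ class_KB K B f, admissible_noise sigma Q
                                    & r = risk Q est f]]
                | est in [set est : sample R d n -> cube d -> R
                         | is_estimator est]])%E).
Proof.
exists gamma_choice, c0_choice; split; first exact: gamma_choice_gt.
split; first exact: c0_choice_gt0.
move=> sigma sigma0 eps eps01.
exists (32^-1 * 32^-1), (upper_const sigma eps).
have c0 : 0 < 32^-1 * 32^-1 :> R by rewrite mulr_gt0 ?invr_gt0.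
split=> //; split; first exact: upper_const_gt0.
move=> n d n1 d1; split.
  move=> K B K1 Ks B1 _ dn Q admQ.
  apply: ge_ereal_sup => _ [f fKB <-].
  exact: (fourier_estimator_upper_bound eps01 n1 d1 K1 B1 fKB Ks dn admQ).
move=> K B K0 Kc B0 BK Ld; apply: le_ereal_inf_tmp => _ [est mest <-].
have c32 : 32 * (32 * (32^-1 * 32^-1)) <= 1 :> R by lra.
have [f [Q [fKB admQ le]]] := minimax_lower_bound sigma c0 c32 n1 K0 Kc B0 BK Ld mest.
by apply: le_trans le _; apply: ereal_sup_ubound; exists f, Q.
Qed.
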